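(* Every irrational rotation is the maximal equicontinuous factor of a minimal subshift of symbolic rank $2$. That is, for every irrational number $0<\alpha<1$ there is a minimal subshift $X\subseteq2^{\mathbb{Z}}$ of symbolic rank $2$ such that $(\mathbb{T},+\alpha)$ is the maximal equicontinuous factor of $(X,\sigma)$.
   Context: $\mathbb{T}=\mathbb{R}/\mathbb{Z}$ and $(\mathbb{T},+\alpha)$ is the rotation $t\mapsto t+\alpha$. A topological dynamical system $(X,T)$ is a homeomorphism $T$ of a compact metrizable space $X$. $(Y,S)$ is a factor of $(X,T)$ if there is a factor map, i.e. a continuous surjection $\varphi:X\to Y$ with $\varphi T=S\varphi$. $(X,T)$, with compatible metric $\rho$, is equicontinuous if for all $\epsilon>0$ there is $\delta>0$ such that $\rho(x,y)<\delta$ implies $\rho(T^nx,T^ny)<\epsilon$ for all $n\in\mathbb{Z}$. The maximal equicontinuous factor of $(X,T)$ is an equicontinuous factor $(Y,S)$ with factor map $\varphi$ such that for every equicontinuous factor $(Z,G)$ with factor map $\psi$ there is a factor map $\theta:(Y,S)\to(Z,G)$ with $\psi=\theta\circ\varphi$. $2^{\mathbb{Z}}=\{0,1\}^{\mathbb{Z}}$, $\sigma(x)(n)=x(n+1)$. A subshift is a closed $X\subseteq2^{\mathbb{Z}}$ with $\sigma X=X$; it is minimal if every orbit is dense in $X$. For $V\in\{0,1\}^{\mathbb{N}}$, $X_V=\{x\in 2^{\mathbb{Z}}:$ every finite subword of $x$ is a subword of $V\}$. Let $\mathcal{F}$ be the set of finite $0,1$-words that begin and end with $0$. For finite $S\subseteq\mathcal{F}$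 and $w\in\mathcal{F}$, a building of $w$ from $S$ consists of $v_1,\dots,v_{k+1}\in S$ and nonnegative integers $s_1,\dots,s_k$, $k\ge 1$, with $w=v_1 1^{s_1}v_2\cdots v_k1^{s_k}v_{k+1}$; then $w$ is built from $S$ starting with $v_1$. For $n\ge1$, a rank-$n$ generating sequence is a family $\{v_{i,j}\}_{i\ge0,1\le j\le n_i}$ of finite words such that for all $i\ge 0$: $n_i\le n$; $v_{0,j}=0$ for all $1\le j\le n_0$; $v_{i+1,1}$ is built from $S_i=\{v_{i,1},\dots,v_{i,n_i}\}$ starting with $v_{i,1}$; and $v_{i+1,j}$ is built from $S_i$ for all $2\le j\le n_{i+1}$. A rank-$n$ construction is such a sequence together with one chosen building of each $v_{i+1,j}$ from $S_i$ (that of $v_{i+1,1}$ starting with $v_{i,1}$); it is a construction of the infinite word $V=\lim_i v_{i,1}$. The symbolic rank of a subshift $X$ is the smallest $n\ge 1$ (if any) such that $X=X_V$ for some $V$ having a rank-$n$ construction. *)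

(* Defs.v *)
From HB Require Import structures.
From mathcomp Require Import all_boot all_order all_algebra.
From mathcomp Require Import generic_quotient ring_quotient.
From mathcomp Require Import all_classical all_reals all_analysis.

Set Implicit Arguments.
Unset Strict Implicit.
Unset Printing Implicit Defensive.

Import Order.TTheory GRing.Theory Num.Theory.
Import numFieldNormedType.Exports.

Local Open Scope classical_set_scope.
Local Open Scope ring_scope.

(** * Topological dynamical systems *)

(* The inverse is part of the data, so that negative iterates are available
   without choice; it is determined by [hmap]. *)
Record homeo (X : topologicalType) := Homeo {
  hmap :> X -> X;
  hinv : X -> X;
  hmapK : cancel hmap hinv;
  hinvK : cancel hinv hmap;
  hmap_continuous : continuous hmap;
  hinv_continuous : continuous hinv }.

Definition iterz (X : topologicalType) (f : homeo X) (n : int) : X -> X :=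
  match n with
  | Posz m => iter m f
  | Negz m => iter m.+1 (hinv f)
  end.

Record compatible_metric (R : realType) (X : topologicalType)
    (d : X -> X -> R) : Prop := CompatibleMetric {
  metric_eq0 : forall x y, d x y = 0 <-> x = y;
  metric_symm : forall x y, d x y = d y x;
  metric_triang : forall x y z, d x z <= d x y + d y z;
  metric_nbhs : forall x (A : set X),
    nbhs x A <-> exists2 e : R, 0 < e & [set y | d x y < e] `<=` A }.

Definition compact_metrizable (R : realType) (X : topologicalType) : Prop :=
  compact [set: X] /\ exists d : X -> X -> R, compatible_metric d.

Section Systems.
Variable R : realType.

Definition equicontinuous_homeo (X : topologicalType) (f : homeo X) : Prop :=
  exists2 d : X -> X -> R, compatible_metric d &
    forall e : R, 0 < e -> exists2 delta : R, 0 < delta &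
      forall x y, d x y < delta ->
        forall n : int, d (iterz f n x) (iterz f n y) < e.

Definition factor_map (X Y : topologicalType) (f : homeo X) (g : homeo Y)
    (phi : X -> Y) : Prop :=
  [/\ continuous phi, (forall y, exists x, phi x = y) & phi \o f = g \o phi].

Definition maximal_equicontinuous_factor (X Y : topologicalType)
    (f : homeo X) (g : homeo Y) : Prop :=
  [/\ compact_metrizable R X, compact_metrizable R Y,
      equicontinuous_homeo g &
      exists2 phi : X -> Y, factor_map f g phi &
        forall (Z : topologicalType) (h : homeo Z) (psi : X -> Z),
          compact_metrizable R Z -> equicontinuous_homeo h ->
          factor_map f h psi ->
          exists2 theta : Y -> Z, factor_map g h theta & psi = theta \o phi].

End Systems.

Definition minimal (X : topologicalType) (f : homeo X) : Prop :=
  forall x : X, dense [set iterz f n x | n in [set: int]].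

Section Restriction.
Variables (X : topologicalType) (f : homeo X) (A : set X).
Hypothesis fA : f @` A = A.

Lemma restrict_mem (x : A) : f (\val x) \in A.
Proof.
have fAP y : A y -> A (f y) by move=> Ay; rewrite -fA; exists y.
by apply/mem_set/fAP; exact: set_valP.
Qed.

Lemma restrict_inv_mem (x : A) : hinv f (\val x) \in A.
Proof.
have fAP y : A y -> A (hinv f y).
  by rewrite -{1}fA => -[z Az <-]; rewrite hmapK.
by apply/mem_set/fAP; exact: set_valP.
Qed.

Definition restrict_map (x : A) : A := exist _ (f (\val x)) (restrict_mem x).

Definition restrict_inv (x : A) : A :=
  exist _ (hinv f (\val x)) (restrict_inv_mem x).

Lemma restrict_mapK : cancel restrict_map restrict_inv.
Proof. by move=> x; apply: val_inj; rewrite /= hmapK. Qed.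

Lemma restrict_invK : cancel restrict_inv restrict_map.
Proof. by move=> x; apply: val_inj; rewrite /= hinvK. Qed.

Lemma restrict_map_continuous : continuous restrict_map.
Proof.
apply/continuousP => _ [B oB <-].
exists (f @^-1` B); last by [].
by apply: open_comp => // x _; exact: hmap_continuous.
Qed.

Lemma restrict_inv_continuous : continuous restrict_inv.
Proof.
apply/continuousP => _ [B oB <-].
exists (hinv f @^-1` B); last by [].
by apply: open_comp => // x _; exact: hinv_continuous.
Qed.

Definition restrict_homeo : homeo A :=
  Homeo restrict_mapK restrict_invK
        restrict_map_continuous restrict_inv_continuous.

End Restriction.

(** * Rotations of the circle *)

Definition integers (R : realType) : {pred R} := [pred x | x \is a Num.int].

Lemma integers_zmod_closed (R : realType) : zmod_closed (@integers R).
Proof. by split=> [|x y]; rewrite !inE; [exact: rpred0|exact: rpredB]. Qed.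

HB.instance Definition _ (R : realType) :=
  GRing.isZmodClosed.Build R (@integers R) (@integers_zmod_closed R).

Definition circle (R : realType) : Type :=
  quotient_topology {ideal_quot (@integers R)}.

HB.instance Definition _ (R : realType) := Topological.on (circle R).

Section Rotation.
Variable R : realType.
Local Open Scope quotient_scope.
Local Notation RmodZ := {ideal_quot (@integers R)}.

(* [circle R] is the group [RmodZ] with the quotient topology; the casts
   select the group structure. *)
Definition rotate (a : R) (t : circle R) : circle R :=
  (t : RmodZ) + \pi_RmodZ a.

Lemma rotate_pi (a x : R) :
  rotate a (\pi_RmodZ x : circle R) = (\pi_RmodZ (x + a) : circle R).
Proof. by rewrite /rotate raddfD. Qed.

Lemma rotateK (a : R) : cancel (rotate a) (rotate (- a)).
Proof. by move=> t; rewrite /rotate -addrA -raddfD subrr raddf0 addr0. Qed.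

Lemma rotateNK (a : R) : cancel (rotate (- a)) (rotate a).
Proof. by move=> t; rewrite /rotate -addrA -raddfD addNr raddf0 addr0. Qed.

Lemma rotate_continuous (a : R) : continuous (rotate a).
Proof.
apply/(@quotient_continuous R {ideal_quot (@integers R)}).
rewrite (_ : _ \o _ =
  (\pi_(quotient_topology RmodZ) : R -> circle R) \o (+%R^~ a)).
  move=> x; apply: continuous_comp.
    by apply: cvgD; [exact: cvg_id|exact: cvg_cst].
  exact: (@pi_continuous R).
by apply/funext => x; exact: rotate_pi.
Qed.

Definition rotation (a : R) : homeo (circle R) :=
  Homeo (@rotateK a) (@rotateNK a)
        (@rotate_continuous a) (@rotate_continuous (- a)).

End Rotation.

(** * Subshifts *)

Definition fullshift : Type := prod_topology (fun _ : int => bool).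

HB.instance Definition _ := Topological.on fullshift.

Definition translate (k : int) (x : fullshift) : fullshift :=
  fun n => x (n + k).

Lemma translateK (k : int) : cancel (translate k) (translate (- k)).
Proof. by move=> x; apply/funext => n; rewrite /translate subrK. Qed.

Lemma translateNK (k : int) : cancel (translate (- k)) (translate k).
Proof. by move=> x; apply/funext => n; rewrite /translate addrK. Qed.

Lemma translate_continuous (k : int) : continuous (translate k).
Proof.
move=> x; apply/cvg_sup => n.
apply: (@continuous_comp_initial _ fullshift bool (fun y : fullshift => y n)).
exact: (@proj_continuous int (fun=> bool) (n + k)).
Qed.

Definition bishift : homeo fullshift :=
  Homeo (@translateK 1) (@translateNK 1)
        (@translate_continuous 1) (@translate_continuous (- 1)).

Record subshift := Subshift {
  subshift_set :> set fullshift;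
  subshift_closed : closed subshift_set;
  subshift_shift : bishift @` subshift_set = subshift_set }.

Definition subshift_map (X : subshift) : homeo (X : set fullshift) :=
  restrict_homeo (subshift_shift X).

(** * Symbolic rank *)

(* The letters 0 and 1 are [false] and [true]. *)
Definition word : Type := seq bool.

Definition subword_biinf (u : word) (x : fullshift) : Prop :=
  exists k : int, u = mkseq (fun i : nat => x (k + i%:Z)) (size u).

Definition subword_inf (u : word) (V : nat -> bool) : Prop :=
  exists k : nat, u = mkseq (fun i : nat => V (k + i)%N) (size u).

Definition subshift_of_word (V : nat -> bool) : set fullshift :=
  [set x | forall u : word, subword_biinf u x -> subword_inf u V].

(* The default letter [true] makes the empty word fail both tests. *)
Definition starts_ends_0 (w : word) : bool :=
  (head true w == false) && (last true w == false).

(* [:: (s_1, v_2); ...; (s_k, v_{k+1})] is the list [btail] of the building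
   v_1 1^{s_1} v_2 ... v_k 1^{s_k} v_{k+1}, and v_1 is [bhead]. *)
Record building (S : seq word) (w : word) := Building {
  bhead : word;
  btail : seq (nat * word);
  bhead_in : bhead \in S;
  btail_in : all (fun p => p.2 \in S) btail;
  btail_neq0 : btail != [::];
  buildingE : w = bhead ++ flatten [seq nseq p.1 true ++ p.2 | p <- btail] }.

Definition built_from (S : seq word) (w : word) : Prop :=
  exists b : building S w, True.

Definition built_from_starting (S : seq word) (u w : word) : Prop :=
  exists b : building S w, bhead b = u.

Definition level (n : nat -> nat) (v : nat -> nat -> word) (i : nat) :
    seq word :=
  [seq v i j | j <- iota 1 (n i)].

(* [gword i j] is meaningful for [1 <= j <= gsize i] only.  [gword_F], under
   which buildings are defined, follows from the fields after it; so does
   [1 <= gsize i]. *)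
Record generating_sequence (r : nat) := GeneratingSequence {
  gsize : nat -> nat;
  gword : nat -> nat -> word;
  gsize_bounds : forall i, (1 <= gsize i <= r)%N;
  gword_F : forall i j, (1 <= j <= gsize i)%N -> starts_ends_0 (gword i j);
  gword0 : forall j, (1 <= j <= gsize 0)%N -> gword 0 j = [:: false];
  gword1_built : forall i,
    built_from_starting (level gsize gword i) (gword i 1) (gword i.+1 1);
  gword_built : forall i j, (2 <= j <= gsize i.+1)%N ->
    built_from (level gsize gword i) (gword i.+1 j) }.

Record rank_construction (r : nat) := RankConstruction {
  cseq :> generating_sequence r;
  cbuilding : forall i j, (1 <= j <= gsize cseq i.+1)%N ->
    building (level (gsize cseq) (gword cseq) i) (gword cseq i.+1 j);
  cbuilding1 : forall i (h : (1 <= 1 <= gsize cseq i.+1)%N),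
    bhead (cbuilding h) = gword cseq i 1 }.

(* Every letter of [v_{i,1}] at a fixed position exists and equals that of [V]
   for all large [i], i.e. [V] is the limit of the words [v_{i,1}]. *)
Definition construction_of (r : nat) (c : rank_construction r)
    (V : nat -> bool) : Prop :=
  forall k : nat, \forall i \near \oo,
    (k < size (gword c i 1))%N /\ nth true (gword c i 1) k = V k.

Definition has_rank_construction (X : set fullshift) (r : nat) : Prop :=
  exists (V : nat -> bool) (c : rank_construction r),
    construction_of c V /\ X = subshift_of_word V.

Definition symbolic_rank (X : set fullshift) (r : nat) : Prop :=
  [/\ (1 <= r)%N, has_rank_construction X r &
      forall m : nat, (1 <= m)%N -> has_rank_construction X m -> (r <= m)%N].

(* Main.v *)
Require Import Defs.
From mathcomp Require Import all_boot all_order all_algebra.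
From mathcomp Require Import generic_quotient ring_quotient.
From mathcomp Require Import all_classical all_reals all_analysis.
From mathcomp Require Import ring lra zify.
Set Implicit Arguments.
Unset Strict Implicit.
Unset Printing Implicit Defensive.
Import Order.TTheory GRing.Theory Num.Theory.
Import numFieldNormedType.Exports.
Local Open Scope classical_set_scope.
Local Open Scope ring_scope.

(** Let [X] be the Sturmian subshift of slope [alpha]: the sequences in which
    every window of length [l] contains [l * alpha] occurrences of a fixed letter
    [c], up to an error of at most 1.  Such a sequence codes a point of the circle,
    its phase, and the phase is a continuous factor map onto the rotation.  Its
    fibres consist of asymptotic recurrent points, so every equicontinuous factor
    is constant on them.  Every window of one sequence with this property occurs
    infinitely often in every other, so [X] is minimal, and [X = X_V] for every
    one-sided [V] with the property.

    Choose [c] so that the letter 0 has frequency [g < 1/2], and let [V] code the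
    orbit of the left end of the exchange of two intervals of lengths [g], [1 - g].
    Inducing on initial intervals replaces the names [(A, B)] of the two Rokhlin
    towers by [(A, A B)] or [(A B, B)]; grouped as [(A^(k+1) B, A^k B)] or
    [(A B^k, A B^(k+1))] with [k >= 1] these steps keep the form
    [A = P 1^s, B = Q 1^s'], and the words [P], [Q] form a rank-2 construction.

    If [X = X_V'] with [V'] of rank 1, then [V'] is recurrent, hence the right half
    of a point of [X].  It is a concatenation of copies of a long word [v] separated
    by runs of 1.  The length of a run is determined by the discrepancy between
    consecutive copies, which is nearly 0; so all runs have the same length and
    [V'] is periodic, which contradicts irrationality. *)

(** * Rotations and balanced sequences *)

Lemma irrational_int (R : realType) (a : R) (m n : int) :
  irrational a -> m%:~R * a = n%:~R -> m = 0.
Proof.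
move=> irr e; apply/eqP/negP => /negP m0; apply: irr.
exists (n%:Q / m%:Q) => //.
rewrite fmorph_div /= !ratr_int -e mulrC mulKf // intr_eq0 //.
Qed.

Lemma irrational_opp1 (R : realType) (a : R) : irrational a -> irrational (1 - a).
Proof.
move=> irr [q _ e]; apply: irr; exists (1 - q) => //.
rewrite rmorphB /= rmorph1 e; ring.
Qed.

Lemma intr_near_eq (R : realType) (m n : int) :
  `|m%:~R - n%:~R : R| < 1 -> m = n.
Proof.
rewrite -intrB -intr_norm -[1]/(1%:~R) ltr_int => h; lia.
Qed.

Lemma natr_near_eq (R : realType) (m n : nat) :
  `|m%:R - n%:R : R| < 1 -> m = n.
Proof. by move=> h; have [] := @intr_near_eq R m n h. Qed.

(** Pigeonhole: two of the [M + 1] fractional parts [fr i] fall into the same one of [M] boxes of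
    width [1 / M], and irrationality keeps them distinct. *)
Lemma small_multiple (R : realType) (a e : R) : irrational a -> 0 < e ->
  exists (q : nat) (p : int), 0 < `|q%:R * a - p%:~R| < e.
Proof.
move=> irr e0; set M := (Num.truncn e^-1).+1.
have Me : M%:R^-1 < e :> R.
  by rewrite invf_plt ?posrE ?ltr0n // truncnS_gt.
pose fr (i : nat) : R := i%:R * a - (Num.floor (i%:R * a))%:~R.
have fr01 i : 0 <= fr i < 1.
  by rewrite /fr subr_ge0 floor_le ltrBlDl -intrD1 floorD1_gt.
have frM i : (Num.truncn (M%:R * fr i) < M)%N.
  have /andP[f0 f1] := fr01 i.
  rewrite -(ltr_nat R); apply: (@le_lt_trans _ _ (M%:R * fr i)).
    by rewrite truncn_le // mulr_ge0.
  by rewrite gtr_pMr // ltr0n.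
pose F (i : 'I_M.+1) : 'I_M := Ordinal (frM i).
have /injectivePn[i [j ij /(congr1 val) /= Fij]] : ~~ injectiveb F.
  apply/negP => /injectiveP /leq_card; rewrite !card_ord; lia.
wlog lt : i j ij Fij / (j < i)%N.
  move=> W; have [/W|/W|/val_inj e1] := ltngtP j i; [exact|apply|].
  - by rewrite eq_sym.
  - by [].
  by rewrite e1 eqxx in ij.
exists (i - j)%N, (Num.floor (i%:R * a) - Num.floor (j%:R * a)).
have -> : (i - j)%N%:R * a - (Num.floor (i%:R * a) - Num.floor (j%:R * a))%:~R
    = fr i - fr j.
  by rewrite natrB 1?ltnW // intrB /fr; ring.
apply/andP; split.
  rewrite normr_gt0 subr_eq0; apply/eqP => eqf.
  have : (i%:Z - j%:Z)%:~R * a = (Num.floor (i%:R * a) - Num.floor (j%:R * a))%:~R.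
    by move: eqf; rewrite /fr !intrB /= => eqf; lra.
  by move/(irrational_int irr); lia.
apply: lt_trans Me; rewrite -(@ltr_pM2l _ M%:R) ?ltr0n // divff ?pnatr_eq0 //.
have /andP[fi0 fi1] := fr01 i; have /andP[fj0 fj1] := fr01 j.
have := @truncn_itv _ (M%:R * fr i) (mulr_ge0 (ler0n _ _) fi0).
have := @truncn_itv _ (M%:R * fr j) (mulr_ge0 (ler0n _ _) fj0).
have -> : M%:R * `|fr i - fr j| = `|M%:R * fr i - M%:R * fr j|.
  by rewrite -mulrBr normrM ger0_norm.
rewrite Fij ltr_norml -natr1.
by move=> /andP[h1 h2] /andP[h3 h4]; apply/andP; split; lra.
Qed.

(** Steps of size [|d| < e] cannot jump over an arc of length [e], and about [1 / |d|] of them go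
    round the circle whatever [t] is. For [d > 0] the walk stops at or just past the next integer,
    for [d < 0] just before crossing the floor of [t]. *)
Lemma dense_rotation_ge (R : realType) (a e : R) : irrational a -> 0 < e ->
  exists N : nat, forall t : R, exists (j : nat) (k : int),
    (j <= N)%N /\ 0 <= t + j%:R * a - k%:~R < e.
Proof.
move=> irr e0; have [q [p]] := small_multiple irr e0.
set d := _ - _ => /andP[d0 de].
exists ((Num.truncn `|d|^-1).+1 * q)%N => t.
have ft := floor_le t; have ft1 := floorD1_gt t; rewrite intrD1 in ft1.
set f := t - (Num.floor t)%:~R.
have bound g : 0 <= g <= 1 ->
    (Num.truncn (g / `|d|) <= Num.truncn `|d|^-1)%N.
  move=> /andP[g0 g1]; apply: le_truncn; rewrite ler_piMl // invr_ge0 ltW.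
have dE l : (l * q)%N%:R * a = l%:R * d + (l%:Z * p)%:~R.
  by rewrite natrM intrM /d /=; ring.
case: (ltrgtP 0 d) => [dp|dn|d00]; last by rewrite -d00 normr0 ltxx in d0.
- rewrite gtr0_norm // in d0 de bound *.
  set g := 1 - f.
  have g01 : 0 <= g <= 1 by rewrite /g /f; lra.
  have /andP[l1 l2] := @truncn_itv _ (g / d) (divr_ge0 (proj1 (andP g01)) (ltW dp)).
  set l := Num.truncn _ in l1 l2; rewrite ler_pdivlMr // in l1; rewrite ltr_pdivrMr // in l2.
  exists (l.+1 * q)%N, (l.+1%:Z * p + Num.floor t + 1); split.
    by rewrite leq_mul2r ltnS bound ?orbT.
  rewrite dE !intrD /=; rewrite /g /f -natr1 in l1 l2 *; apply/andP; split; lra.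
- rewrite ltr0_norm // in d0 de bound *.
  have g01 : 0 <= f <= 1 by rewrite /f; lra.
  have /andP[l1 l2] := @truncn_itv _ (f / (- d)) (divr_ge0 (proj1 (andP g01)) (ltW d0)).
  set l := Num.truncn _ in l1 l2; rewrite ler_pdivlMr // in l1; rewrite ltr_pdivrMr // in l2.
  exists (l * q)%N, (l%:Z * p + Num.floor t); split.
    by rewrite leq_mul2r leqW ?orbT // bound.
  rewrite dE !intrD /=; rewrite /f -natr1 in l1 l2 *; apply/andP; split; lra.
Qed.

Lemma dense_rotation (R : realType) (a e : R) : irrational a -> 0 < e ->
  exists N : nat, forall t : R, exists (j : nat) (k : int),
    (j <= N)%N /\ 0 < t + j%:R * a - k%:~R < e.
Proof.
move=> irr e0; have e2 : 0 < e / 2 by rewrite divr_gt0.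
have [N HN] := dense_rotation_ge irr e2; exists N => t.
(* Starting at [t - e / 2] makes the lower bound strict. *)
have [j [k [jN h]]] := HN (t - e / 2).
by exists j, k; split=> //; lra.
Qed.

(** * Discrepancy and phase of one-sided sequences *)

Section Discrepancy.
Context (R : realType) (a : R) (c : bool).
Implicit Types (x y : nat -> bool).

Definition occ y n : nat := \sum_(i < n) (y i == c).

Definition disc y n : R := (occ y n)%:R - n%:R * a.

(** The difference of two prefix discrepancies is, up to sign, the discrepancy of the window between
    them, so the bound concerns every window. *)
Definition balanced y := forall m n, `|disc y m - disc y n| <= 1.

Lemma occS y n : occ y n.+1 = (occ y n + (y n == c))%N.
Proof. by rewrite /occ big_ord_recr. Qed.

Lemma occD y j n : occ y (j + n) = (occ y j + occ (fun i => y (j + i)%N) n)%N.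
Proof.
elim: n => [|n IH]; first by rewrite addn0 /occ big_ord0 addn0.
by rewrite addnS !occS IH addnA.
Qed.

Lemma disc0 y : disc y 0 = 0.
Proof. by rewrite /disc /occ big_ord0 mul0r subrr. Qed.

Lemma discD y j n : disc y (j + n) = disc y j + disc (fun i => y (j + i)%N) n.
Proof. by rewrite /disc occD !natrD; ring. Qed.

Lemma disc_shift y j n : disc (fun i => y (j + i)%N) n = disc y (j + n) - disc y j.
Proof. by rewrite discD; ring. Qed.

Lemma balanced_shift y j : balanced y -> balanced (fun i => y (j + i)%N).
Proof.
move=> b m n; have := b (j + m)%N (j + n)%N.
by rewrite (discD y j m) (discD y j n) opprD addrACA subrr add0r.
Qed.

Lemma eq_occ x y n : (forall i, (i < n)%N -> x i = y i) -> occ x n = occ y n.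
Proof. by move=> e; apply: eq_bigr => i _; rewrite e. Qed.

Lemma eq_disc x y n : (forall i, (i < n)%N -> x i = y i) -> disc x n = disc y n.
Proof. by move=> e; rewrite /disc (eq_occ e). Qed.

Lemma occ_letter x y n : occ x n = occ y n -> occ x n.+1 = occ y n.+1 -> x n = y n.
Proof.
rewrite !occS => -> /addnI; by case: (x n); case: (y n); case: c.
Qed.

Hypothesis irr : irrational a.

(* A difference equal to 1 would make a nonzero multiple of [a] an integer. *)
Lemma disc_lt1 y m n : balanced y -> disc y m - disc y n < 1.
Proof.
move=> b; have := b m n; rewrite ler_norml => /andP[_]; rewrite le_eqVlt.
case/orP=> // /eqP; rewrite /disc => e.
have e' : (n%:Z - m%:Z)%:~R * a = (1 - (occ y m)%:Z + (occ y n)%:Z)%:~R.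
  by rewrite !intrD !mulrNz /=; lra.
have := irrational_int irr e' => mn.
have mn' : m = n by lia.
by move: e; rewrite mn' subrr => /esym/eqP; rewrite oner_eq0.
Qed.

Lemma max_exists (f : nat -> R) N :
  exists2 n, (n <= N)%N & forall m, (m <= N)%N -> f m <= f n.
Proof.
elim: N => [|N [n nN H]].
  by exists 0%N => // m; rewrite leqn0 => /eqP ->.
have [h|h] := lerP (f N.+1) (f n).
  exists n; first exact: leqW.
  by move=> m; rewrite leq_eqVlt => /orP[/eqP ->|/H].
exists N.+1 => // m; rewrite leq_eqVlt => /orP[/eqP -> //|/H hm].
exact: le_trans hm (ltW h).
Qed.

Lemma min_exists (f : nat -> R) N :
  exists2 n, (n <= N)%N & forall m, (m <= N)%N -> f n <= f m.
Proof.
have [n nN H] := max_exists (fun n => - f n) N.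
by exists n => // m /H; rewrite lerN2.
Qed.

(* [t] is a point of the circle coded by [y]: [occ y n] is the floor of
   [t + n a], except possibly at the one [n] where [t + n a] is an integer. *)
Definition is_phase y t := forall n, disc y n <= t <= disc y n + 1.

(** The supremum of the discrepancies is a phase, because they oscillate by at most 1. *)
Lemma phase_exists y : balanced y -> exists t, is_phase y t.
Proof.
move=> b; exists (sup (range (disc y))) => n.
have ub m : ubound (range (disc y)) (disc y m + 1).
  by move=> _ [k _ <-]; have := b k m; rewrite ler_norml => /andP[_]; lra.
have ne : range (disc y) !=set0 by exists (disc y 0); exists 0%N.
apply/andP; split; last exact: ge_sup.
by apply: ub_le_sup; [exists (disc y 0 + 1); exact: ub|exists n].
Qed.

Lemma phase_shift y t j : is_phase y t ->
  is_phase (fun i => y (j + i)%N) (t - disc y j).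
Proof. by move=> h n; rewrite disc_shift; have := h (j + n)%N; lra. Qed.

(** Modulo 1, [disc y j] is [- j * a]. If the values up to [N] spread over at most [1 - e], they
    would miss an arc of length [e] that this orbit enters by time [N]. The bound [N] is independent
    of [y]. *)
Lemma disc_range e : 0 < e -> exists N, forall y,
  exists m n, [/\ (m <= N)%N, (n <= N)%N & 1 - e < disc y m - disc y n].
Proof.
move=> e0; have [N HN] := dense_rotation irr e0; exists N => y.
have [m mN Hm] := max_exists (disc y) N; have [n nN Hn] := min_exists (disc y) N.
exists m, n; split=> //; rewrite ltNge; apply/negP => small.
have [j [k [jN /andP[h1 h2]]]] := HN (disc y m + e).
have := Hm j jN; have := Hn j jN; set u := disc y m in h1 h2 small *.
set w := disc y n in small *; rewrite /disc => H1 H2.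
have ek : (occ y j)%:Z = k.
  apply: (@intr_near_eq R); rewrite ltr_norml /=; apply/andP; split; lra.
by rewrite -ek /= in h1 h2; lra.
Qed.

Lemma phase_unique y t u : is_phase y t -> is_phase y u -> t = u.
Proof.
wlog tu : t u / t <= u.
  by move=> W; have [/W //|/ltW /W h ? ?] := lerP t u; apply/esym/h.
move=> ht hu; apply/eqP; rewrite eq_le tu /= leNgt; apply/negP => lt.
have [N HN] := disc_range (e := u - t) ltac:(lra).
have [m [n [_ _]]] := HN y; have := ht m; have := hu n; lra.
Qed.

(* The phases of a finite window form a nondegenerate interval, which the
   orbit of the phase of [y] visits. *)
Lemma window_recurs x y N j0 : balanced x -> balanced y ->
  exists2 j, (j0 <= j)%N & forall i, (i < N)%N -> y (j + i)%N = x i.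
Proof.
move=> bx by0.
have [m mN Hm] := max_exists (disc x) N; have [n nN Hn] := min_exists (disc x) N.
have lt := disc_lt1 m n bx.
have by1 := balanced_shift j0 by0; set y1 := fun i => _ in by1.
have [t ht] := phase_exists by1.
have [N' HN] := dense_rotation irr (e := disc x n + 1 - disc x m) ltac:(lra).
have [j [k [_ /andP[h1 h2]]]] := HN (t - disc x m).
exists (j0 + j)%N; first exact: leq_addr.
(* Since [disc x 0 = 0], this interval lies in the unit interval, which forces [k] to be the count
   [occ y1 j]. *)
have Hm0 := Hm 0%N (leq0n _); have Hn0 := Hn 0%N (leq0n _).
rewrite disc0 in Hm0 Hn0.
have ek : k = occ y1 j.
  apply: (@intr_near_eq R) => /=; have := ht j; rewrite /disc => /andP[h3 h4].
  by rewrite ltr_norml; apply/andP; split; lra.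
have eqo i : (i <= N)%N -> occ (fun r => y1 (j + r)%N) i = occ x i.
  move=> iN; apply: (@natr_near_eq R).
  have := Hm i iN; have := Hn i iN; have := phase_shift j ht i.
  rewrite ek /= in h1 h2.
  set u := disc x m in h1 h2 *; set w := disc x n in h1 h2 *.
  rewrite /disc => /andP[h5 h6] h4 h3.
  by rewrite ltr_norml; apply/andP; split; lra.
move=> i iN; have := @occ_letter (fun r => y1 (j + r)%N) x i (eqo _ (ltnW iN)) (eqo _ iN).
by rewrite /y1 addnA.
Qed.

(** When [t + n * a] is not an integer, both counts are floors and differ by exactly [k].
    Irrationality allows at most one exceptional [n], and past it equal increments mean equal
    letters. *)
Lemma phase_tail_eq x y t u (k : int) : is_phase x t -> is_phase y u ->
  t = u + k%:~R -> exists M, forall n, (M <= n)%N -> x n = y n.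
Proof.
move=> hx hy e.
pose E n := (occ x n)%:Z = (occ y n)%:Z + k.
have Eint n : ~ E n -> exists m : int, t + n%:R * a = m%:~R.
  move=> nE; apply: contrapT => nint; apply: nE; apply: (@intr_near_eq R).
  have := hx n; have := hy n; rewrite /disc => /andP[h3 h4] /andP[h1 h2].
  have n1 : t + n%:R * a != (occ x n)%:R.
    by apply/eqP => h; apply: nint; exists (occ x n).
  have n2 : t + n%:R * a != (occ y n)%:R + k%:~R.
    by apply/eqP => h; apply: nint; exists ((occ y n)%:Z + k); rewrite intrD.
  have n1' : (occ x n)%:R < t + n%:R * a by rewrite lt_neqAle eq_sym n1 /=; lra.
  have n2' : (occ y n)%:R + k%:~R < t + n%:R * a.
    by rewrite lt_neqAle eq_sym n2 /=; lra.
  by rewrite intrD /= ltr_norml; apply/andP; split; lra.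
have [M HM] : exists M, forall n, (M <= n)%N -> E n.
  have [[m nEm]|noE] := pselect (exists m, ~ E m); last first.
    by exists 0%N => n _; apply: contrapT => nE; apply: noE; exists n.
  exists m.+1 => n mn; apply: contrapT => nEn.
  have [p ep] := Eint _ nEm; have [q eq] := Eint _ nEn.
  have := @irrational_int R a (n%:Z - m%:Z) (q - p) irr.
  rewrite !intrB /= => /(_ ltac:(lra)); lia.
exists M => n Mn; have := HM n Mn; have := HM n.+1 (leqW Mn); rewrite /E !occS.
by case: (x n); case: (y n); case: c => //=; lia.
Qed.

End Discrepancy.

(** * Sturmian subshifts *)

Definition window (x : fullshift) (K : nat) : set fullshift :=
  [set y | forall k : int, (`|k| < K)%N -> y k = x k].

Lemma nbhs_coordinate (x : fullshift) (k : int) :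
  nbhs x [set y : fullshift | y k = x k].
Proof.
have := @proj_continuous int (fun=> bool) k x.
by move=> /(_ [set x k]); apply; rewrite nbhs_principalE.
Qed.

(** The windows of [x] generate a filter that converges in each coordinate, hence in the product
    topology. Conversely a window is a finite intersection of coordinate neighbourhoods. *)
Lemma nbhs_fullshift (x : fullshift) (A : set fullshift) :
  nbhs x A <-> exists K, window x K `<=` A.
Proof.
split=> [|[K KA]].
  pose F : set_system fullshift := [set B | exists K, window x K `<=` B].
  have FF : Filter F.
    split.
    - by exists 0%N.
    - move=> P Q [K KP] [L LQ]; exists (maxn K L) => y h; split.
        by apply: KP => k hk; apply: h; rewrite leq_max hk.
      by apply: LQ => k hk; apply: h; rewrite leq_max hk orbT.
    - by move=> P Q PQ [K KP]; exists K; exact: subset_trans PQ.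
  suff : F --> x by move=> h /h.
  apply/cvg_sup => i B; rewrite nbhsE => -[C [[U oU <-] Cx] CB].
  exists `|i|.+1 => y /(_ i (ltnSn _)) e; apply: CB.
  by rewrite /preimage /= /prod_topology e.
apply: filterS KA _; elim: K => [|K IH]; first by apply: filterS filterT.
apply: filterS (filterI IH (filterI (nbhs_coordinate x K%:Z)
  (nbhs_coordinate x (- K%:Z)))) => y [h [h1 h2]] k.
rewrite ltnS leq_eqVlt => /orP[/eqP kK|/h //].
by have [->|->] : k = K%:Z \/ k = - K%:Z by lia.
Qed.

Lemma fullshift_compact : compact [set: fullshift].
Proof.
have := @tychonoff int (fun=> bool) (fun=> setT) (fun=> bool_compact).
by rewrite (_ : [set f | _] = setT) // -subTset => f _ i.
Qed.

Lemma fullshift_closed (A : set fullshift) :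
  (forall x, (forall K, exists2 y, window x K y & A y) -> A x) -> closed A.
Proof.
move=> h x clx; apply: h => K; have [|y [Ay wy]] := clx (window x K).
  by apply/nbhs_fullshift; exists K.
by exists y.
Qed.

Lemma window_sym x y K : window x K y -> window y K x.
Proof. by move=> h k /h ->. Qed.

Lemma window_trans x y z K : window x K y -> window y K z -> window x K z.
Proof. by move=> h1 h2 k kK; rewrite h2 // h1. Qed.

Lemma window_le x y K L : (K <= L)%N -> window x L y -> window x K y.
Proof. by move=> KL h k kK; apply: h; exact: leq_trans KL. Qed.

Section ShiftMetric.
Variable R : realType.

(** The infimum over all radii of agreement treats [x = y] uniformly: all radii occur and the value
    is 0. *)
Definition shift_dist (x y : fullshift) : R :=
  inf [set K.+1%:R^-1 | K in [set K | window x K y]].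

Lemma shift_dist_has_inf (x y : fullshift) :
  has_inf [set (K.+1%:R^-1 : R) | K in [set K | window x K y]].
Proof.
split; first by exists (1%:R^-1); exists 0%N.
by exists 0 => _ [K _ <-]; rewrite invr_ge0.
Qed.

Lemma shift_dist_lt x y e :
  shift_dist x y < e <-> exists2 K : nat, window x K y & K.+1%:R^-1 < e.
Proof.
split=> [/(inf_lt (shift_dist_has_inf x y).1)[_ [K wK <-] lt]|[K wK]].
  by exists K.
by apply: le_lt_trans; apply: ge_inf; [case: (shift_dist_has_inf x y)|exists K].
Qed.

Lemma shift_dist_ge0 x y : 0 <= shift_dist x y.
Proof.
apply: lb_le_inf; first by case: (shift_dist_has_inf x y).
by move=> _ [K _ <-]; rewrite invr_ge0.
Qed.

Lemma invS_small (e : R) : 0 < e -> exists K : nat, K.+1%:R^-1 < e.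
Proof.
by move=> e0; exists (Num.truncn e^-1); rewrite invf_plt ?posrE ?ltr0n // truncnS_gt.
Qed.

Lemma shift_dist_triang x y z :
  shift_dist x z <= shift_dist x y + shift_dist y z.
Proof.
apply/ler_addgt0Pr => e e0.
have [K wK ltK] := (shift_dist_lt x y (shift_dist x y + e / 2)).1 ltac:(lra).
have [L wL ltL] := (shift_dist_lt y z (shift_dist y z + e / 2)).1 ltac:(lra).
have := shift_dist_ge0 x y; have := shift_dist_ge0 y z => h1 h2.
apply: ltW; apply/shift_dist_lt; have [KL|LK] := leqP K L.
  by exists K; [apply: window_trans wK _; exact: window_le KL wL|apply: (lt_trans ltK); lra].
exists L; last by apply: (lt_trans ltL); lra.
by apply: window_trans wL; apply: window_le wK; exact: ltnW.
Qed.

End ShiftMetric.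

Section ClosedSubsets.
Variable A : set fullshift.

Lemma nbhs_subset (x : A) (B : set A) :
  nbhs x B <-> exists K, forall y : A, window (\val x) K (\val y) -> B y.
Proof.
split=> [|[K KB]].
  rewrite nbhsE => -[C [[U oU <-] Ux] CB].
  have [K KU] : exists K, window (\val x) K `<=` U.
    by apply: (nbhs_fullshift (\val x) U).1; exact: (@open_nbhs_nbhs fullshift _ _ (conj oU Ux)).
  by exists K => y /KU Uy; apply: CB.
have : nbhs (\val x) (window (\val x) K) by apply/nbhs_fullshift; exists K.
move=> /(@initial_continuous A fullshift set_val x) h.
by apply: (@filterS _ (nbhs x) _ _ _ _ h) => y; exact: KB.
Qed.

Lemma closed_subset_compact : closed A -> compact [set: A].
Proof.
move=> cA F FF _.
have cptA : compact A.
  apply: (@subclosed_compact _ A [set: fullshift]) => //; exact: fullshift_compact.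
have FA : (set_val @ F) A.
  by apply: (@filterS _ F _ setT) => [y _|]; [exact: set_valP|exact: filterT].
have [x [Ax clx]] := cptA (set_val @ F) _ FA.
exists (exist _ x (mem_set Ax)); split=> // B C FB /nbhs_subset [K KC].
have [] := clx (set_val @` B) (window x K).
- by apply: (@filterS _ F _ B) => // y By; exists y.
- by apply/nbhs_fullshift; exists K.
by move=> _ [[y By <-] wy]; exists y; split=> //; exact: KC.
Qed.

Lemma subset_metric (R : realType) :
  compatible_metric (fun x y : A => shift_dist R (\val x) (\val y)).
Proof.
split.
- move=> x y; split=> [d0|->].
    apply: val_inj; apply/funext => k.
    have [|K wK] := (shift_dist_lt (\val x) (\val y) (`|k|.+2%:R^-1 : R)).1.
      by rewrite d0 invr_gt0.
    rewrite ltf_pV2 ?posrE ?ltr0n // ltr_nat ltnS => kK; apply/esym/wK; lia.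
  apply/eqP; rewrite eq_le shift_dist_ge0 andbT; apply/ler_addgt0Pr => e e0.
  have [K Ke] := invS_small e0; rewrite add0r; apply: ltW.
  by apply/shift_dist_lt; exists K.
- move=> x y; rewrite /shift_dist; congr (inf _).
  by apply/seteqP; split=> _ [K wK <-]; exists K => //; exact: window_sym.
- by move=> x y z; exact: shift_dist_triang.
- move=> x B; rewrite nbhs_subset; split=> [[K KB]|[e e0 eB]].
    exists K.+1%:R^-1; first by rewrite invr_gt0 ltr0n.
    move=> y /shift_dist_lt[L wL]; rewrite ltf_pV2 ?posrE ?ltr0n // ltr_nat ltnS.
    by move=> KL; apply: KB; apply: window_le wL; exact: ltnW.
  have [K Ke] := invS_small e0; exists K => y wy; apply: eB.
  by apply/shift_dist_lt; exists K.
Qed.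

Lemma closed_subset_compact_metrizable (R : realType) :
  closed A -> compact_metrizable R A.
Proof.
move=> cA; split; first exact: closed_subset_compact.
by eexists; exact: (@subset_metric R).
Qed.

End ClosedSubsets.

Lemma translate0 x : translate 0 x = x.
Proof. by apply/funext => n; rewrite /translate addr0. Qed.

Lemma val_iterz (X : subshift) n (x : (X : set fullshift)) :
  \val (iterz (subshift_map X) n x) = translate n (\val x).
Proof.
case: n => m /=.
  elim: m => [|m IH]; first by rewrite translate0.
  rewrite iterS /= IH; apply/funext => i; rewrite /translate; congr (\val x _); lia.
elim: m => [|m IH] //=.
rewrite /= in IH; rewrite IH; apply/funext => i; rewrite /translate.
by congr (\val x _); lia.
Qed.

(** * Two-sided balanced sequences and minimality *)

Section Sturmian.
Variables (R : realType) (a : R) (c : bool).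

(** Starting points [k] of both signs make the condition two-sided and shift invariant. *)
Definition sturmian : set fullshift :=
  [set x | forall k : int, balanced a c (fun n => x (k + n%:Z))].

Lemma sturmian_closed : closed sturmian.
Proof.
apply: fullshift_closed => x h k m n.
have [y wy sy] := h (`|k| + m + n)%N.
rewrite -2?(@eq_disc _ a c (fun i => y (k + i%:Z)) (fun i => x (k + i%:Z))).
- exact: sy.
- by move=> i hi; apply: wy; lia.
- by move=> i hi; apply: wy; lia.
Qed.

Lemma sturmian_translate j x : sturmian x -> sturmian (translate j x).
Proof.
move=> sx k; rewrite /translate.
rewrite (_ : (fun n => _) = fun n => x ((k + j) + n%:Z)); first exact: sx.
by apply/funext => n; congr x; rewrite addrAC.
Qed.

Lemma sturmian_shift : bishift @` sturmian = sturmian.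
Proof.
apply/seteqP; split=> [_ [x sx <-]|x sx]; first exact: sturmian_translate.
by exists (translate (- 1) x); [exact: sturmian_translate|exact: translateNK].
Qed.

Definition sturmian_subshift := Subshift sturmian_closed sturmian_shift.

Definition ray (x : fullshift) (n : nat) : bool := x n%:Z.

Lemma sturmian_ray x : sturmian x -> balanced a c (ray x).
Proof.
by move=> /(_ 0); rewrite (_ : (fun n => _) = ray x) //; apply/funext => n; rewrite add0r.
Qed.

Hypothesis irr : irrational a.

Lemma sturmian_recurs (x : fullshift) (y : nat -> bool) K j0 :
  sturmian x -> balanced a c y ->
  exists2 j, (j0 <= j)%N & forall k : int, (`|k| < K)%N -> y (absz (j%:Z + k)) = x k.
Proof.
move=> sx by0.
have [j j0j h] := window_recurs irr (K + K) (j0 + K) (sx (- K%:Z)) by0.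
(* The recurring block starts at position [- K] of [x], so its centre is at [j + K]. *)
exists (j + K)%N; first lia.
move=> k kK; have := h (absz (k + K%:Z)) ltac:(lia).
rewrite (_ : - K%:Z + _ = k); last lia.
by rewrite (_ : (j + _)%N = absz ((j + K)%N%:Z + k)) //; lia.
Qed.

Lemma sturmian_recurs_translate x y K j0 : sturmian x -> sturmian y ->
  exists2 j, (j0 <= j)%N & window x K (translate j%:Z y).
Proof.
move=> sx sy; have [j j0j h] := sturmian_recurs K (j0 + K) sx (sturmian_ray sy).
exists j; first lia.
move=> k kK; rewrite -h // /ray /translate; congr y; lia.
Qed.

Lemma sturmian_minimal : minimal (subshift_map sturmian_subshift).
Proof.
move=> x O [y Oy] oO.
have /nbhs_subset[K KO] : nbhs y O by exact: (open_nbhs_nbhs (conj oO Oy)).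
have [j _ wj] := sturmian_recurs_translate K 0 (set_valP y) (set_valP x).
exists (iterz (subshift_map sturmian_subshift) j%:Z x); split; last by exists j%:Z.
by apply: KO; rewrite val_iterz.
Qed.

End Sturmian.

(** In a window of length [n] the counts of the two letters add up to [n], so passing to the other
    letter and to [1 - a] only negates the discrepancy. *)
Lemma sturmian_compl (R : realType) (a : R) :
  sturmian a true = sturmian (1 - a) false.
Proof.
have occC (y : nat -> bool) n : (occ true y n + occ false y n = n)%N.
  elim: n => [|n IH]; first by rewrite /occ !big_ord0.
  by rewrite !occS; case: (y n) => /=; lia.
have discC (y : nat -> bool) n : disc (1 - a) false y n = - disc a true y n.
  have := congr1 (fun k : nat => k%:R : R) (occC y n).
  by rewrite natrD /disc => e; lra.
have balC y : balanced a true y <-> balanced (1 - a) false y.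
  by split=> b m n; have := b m n; rewrite !discC -opprD normrN.
by apply/seteqP; split=> x sx k; apply/balC.
Qed.

(** * The circle and the maximal equicontinuous factor *)

Section Circle.
Variable R : realType.
Local Open Scope quotient_scope.

Definition circle_pi (x : R) : circle R := \pi_({ideal_quot (@integers R)}) x.

Lemma circle_pi_eq x y :
  circle_pi x = circle_pi y <-> exists k : int, x = y + k%:~R.
Proof.
have P : reflect (circle_pi x = circle_pi y) ((x - y) \in @integers R).
  apply: (iffP idP); rewrite Quotient.idealrBE; first by move/eqP.
  by move=> e; apply/eqP.
split=> [/P|[k e]].
  by rewrite inE => /intrP[k e]; exists k; rewrite -e; ring.
by apply/P; rewrite e inE addrAC subrr add0r intr_int.
Qed.

Lemma circle_piP (t : circle R) : exists x, t = circle_pi x.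
Proof. by exists (repr t); rewrite /circle_pi reprK. Qed.

Lemma circle_pi_continuous : continuous circle_pi.
Proof. exact: (@pi_continuous R {ideal_quot (@integers R)}). Qed.

Lemma circle_open (A : set (circle R)) : open (circle_pi @^-1` A) -> open A.
Proof. by []. Qed.

Definition int_dist (x : R) : R := `|x - (Num.floor (x + 2^-1))%:~R|.

Lemma int_dist_le (x : R) (k : int) : int_dist x <= `|x - k%:~R|.
Proof.
rewrite /int_dist; set m := Num.floor _.
have [->//|km] := eqVneq m k.
have h1 : m%:~R <= x + 2^-1 by exact: floor_le.
have h2 : x + 2^-1 < (m + 1)%:~R by exact: floorD1_gt.
rewrite intrD1 in h2.
have [lt|lt] : (m + 1 <= k) \/ (k + 1 <= m) by lia.
- have h3 : m%:~R + 1 <= k%:~R :> R by rewrite -intrD1 ler_int.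
  by rewrite ler_norml; case: (ger0P (x - k%:~R)) => h; apply/andP; split; lra.
- have h3 : k%:~R + 1 <= m%:~R :> R by rewrite -intrD1 ler_int.
  by rewrite ler_norml; case: (ger0P (x - k%:~R)) => h; apply/andP; split; lra.
Qed.

Lemma int_distD (x : R) (k : int) : int_dist (x + k%:~R) = int_dist x.
Proof.
apply/eqP; rewrite eq_le; apply/andP; split; last first.
  rewrite {2}/int_dist; set m := Num.floor _.
  rewrite (_ : x + _ - _ = x - (m - k)%:~R); first exact: int_dist_le.
  by rewrite intrB; ring.
rewrite {2}/int_dist; set m := Num.floor _.
rewrite (_ : x - _ = x + k%:~R - (m + k)%:~R); first exact: int_dist_le.
by rewrite intrD; ring.
Qed.

Lemma int_distN (x : R) : int_dist (- x) = int_dist x.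
Proof.
suff le y : int_dist (- y) <= int_dist y.
  by apply/eqP; rewrite eq_le le -{1}[x]opprK le.
rewrite {2}/int_dist -normrN opprB addrC.
set m := Num.floor _; rewrite -[m%:~R]opprK -mulrNz.
exact: int_dist_le.
Qed.

Lemma int_dist_triang x y : int_dist (x + y) <= int_dist x + int_dist y.
Proof.
apply: le_trans (ler_normD _ _).
rewrite addrACA -opprD -intrD; exact: int_dist_le.
Qed.

Definition circle_dist (s t : circle R) : R := int_dist (repr s - repr t).

Lemma circle_dist_pi x y :
  circle_dist (circle_pi x) (circle_pi y) = int_dist (x - y).
Proof.
have reprE z : exists k : int, repr (circle_pi z) = z + k%:~R.
  by apply/circle_pi_eq; rewrite {1}/circle_pi reprK.
rewrite /circle_dist; have [k ->] := reprE x; have [l ->] := reprE y.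
rewrite (_ : _ - _ = x - y + (k - l)%:~R) ?int_distD //.
by rewrite intrB; ring.
Qed.

Lemma circle_metric : compatible_metric circle_dist.
Proof.
split.
- move=> s t; have [x ->] := circle_piP s; have [y ->] := circle_piP t.
  rewrite circle_dist_pi; split=> [/normr0_eq0/eqP|e].
    by rewrite subr_eq0 => /eqP e; apply/circle_pi_eq; exists (Num.floor (x - y + 2^-1)); rewrite -e; ring.
  have [k ->] := (circle_pi_eq x y).1 e; apply/eqP; rewrite eq_le normr_ge0 andbT.
  by apply: le_trans (int_dist_le _ k) _; rewrite [y + _]addrC addrK subrr normr0.
- move=> s t; have [x ->] := circle_piP s; have [y ->] := circle_piP t.
  by rewrite !circle_dist_pi -int_distN opprB.
- move=> s t u; have [x ->] := circle_piP s; have [y ->] := circle_piP t.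
  have [z ->] := circle_piP u; rewrite !circle_dist_pi.
  by rewrite -(subrKA y); exact: int_dist_triang.
move=> s A; have [x ->] := circle_piP s; split=> [|[e e0 eA]].
  rewrite nbhsE => -[U [oU Ux] UA].
  have /nbhs_ballP[e /= e0 eU] : nbhs x (circle_pi @^-1` U) by exact: open_nbhs_nbhs.
  exists e => // t /=; have [y ->] := circle_piP t; rewrite circle_dist_pi => lt.
  (* Among the representatives of [circle_pi y], one nearest to [x] is taken. *)
  apply: UA; have -> : circle_pi y = circle_pi (y + (Num.floor (x - y + 2^-1))%:~R).
    by apply/circle_pi_eq; exists (- Num.floor (x - y + 2^-1)); rewrite mulrNz addrK.
  by apply: eU; rewrite /ball /= opprD addrA.
(* A ball of the circle is open since it pulls back to a union of intervals of the line. *)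
have ballE : circle_pi @^-1` [set t | circle_dist (circle_pi x) t < e] =
    \bigcup_(k in [set: int]) [set y | `|x - y - k%:~R| < e].
  apply/seteqP; split=> y /=; rewrite circle_dist_pi.
    by move=> lt; exists (Num.floor (x - y + 2^-1)).
  by case=> k _; apply: le_lt_trans; exact: int_dist_le.
apply: filterS eA _; apply: open_nbhs_nbhs; split; last first.
  rewrite /= circle_dist_pi subrr; apply: le_lt_trans e0.
  by apply: le_trans (int_dist_le _ 0) _; rewrite subr0 normr0.
apply: circle_open; rewrite ballE; apply: bigcup_open => k _.
rewrite (_ : [set y | _] = ball (x - k%:~R) e); first exact: ball_open.
by apply/seteqP; split=> y; rewrite /ball /= addrAC.
Qed.

Lemma circle_compact : compact [set: circle R].
Proof.
rewrite (_ : setT = circle_pi @` `[0, 1]).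
  apply: continuous_compact; last exact: segment_compact.
  by apply: continuous_subspaceT; exact: circle_pi_continuous.
apply/seteqP; split=> // t _; have [x ->] := circle_piP t.
exists (x - (Num.floor x)%:~R); last first.
  by apply/circle_pi_eq; exists (- Num.floor x); rewrite mulrNz.
rewrite /= in_itv /= subr_ge0 floor_le lerBlDl -intrD1.
exact: ltW (floorD1_gt x).
Qed.

Lemma circle_compact_metrizable : compact_metrizable R (circle R).
Proof. by split; [exact: circle_compact|exists circle_dist; exact: circle_metric]. Qed.

Lemma iterz_rotation (b : R) n x :
  iterz (rotation b) n (circle_pi x) = circle_pi (x + n%:~R * b).
Proof.
have H d k : iter k (rotate d) (circle_pi x) = circle_pi (x + k%:R * d).
  elim: k => [|k IH]; first by rewrite mul0r addr0.
  by rewrite iterS IH rotate_pi -natr1; congr circle_pi; ring.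
case: n => m; first exact: H.
by rewrite /= -iterS H NegzE mulrNz mulNr mulrN.
Qed.

Lemma rotation_equicontinuous (b : R) : equicontinuous_homeo R (rotation b).
Proof.
exists circle_dist; first exact: circle_metric.
move=> e e0; exists e => // s t; have [x ->] := circle_piP s.
have [y ->] := circle_piP t; rewrite circle_dist_pi => lt n.
by rewrite !iterz_rotation circle_dist_pi opprD addrACA subrr addr0.
Qed.

End Circle.

Lemma compatible_metric_hausdorff (R : realType) (X : topologicalType) (d : X -> X -> R) :
  compatible_metric d -> hausdorff_space X.
Proof.
move=> md p q cl; apply/(metric_eq0 md); apply/eqP; apply: contraT => d0.
have dxx x : d x x = 0 by apply/(metric_eq0 md).
have dge0 : 0 <= d p q.
  have := metric_triang md p q p; rewrite dxx (metric_symm md q p); lra.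
have dpos : 0 < d p q by rewrite lt_neqAle eq_sym d0.
have e0 : 0 < d p q / 2 by lra.
have nb x : nbhs x [set y | d x y < d p q / 2].
  by apply/(metric_nbhs md); exists (d p q / 2).
have [z [/= h1 h2]] := cl _ _ (nb p) (nb q).
have := metric_triang md p z q; rewrite (metric_symm md z q); lra.
Qed.

(** * The phase as a factor map onto the rotation *)

Section SturmianFactor.
Variables (R : realType) (a : R) (c : bool).
Hypotheses (a01 : 0 < a < 1) (irr : irrational a).
Local Notation X := (sturmian_subshift a c).
Local Notation T := (subshift_map X).

(** The right half of [x] alone determines the phase; 0 is the value when no phase exists. *)
Definition phase (x : fullshift) : R := xget 0 [set t | is_phase a c (ray x) t].

Lemma phaseP x : sturmian a c x -> is_phase a c (ray x) (phase x).
Proof. by move=> sx; exact: (xgetPex 0 (phase_exists (sturmian_ray sx))). Qed.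

Lemma phaseE x t : is_phase a c (ray x) t -> phase x = t.
Proof. by move=> ht; exact: (phase_unique irr (xgetI 0 ht) ht). Qed.

Definition factor (x : (X : set fullshift)) : circle R := circle_pi (phase (\val x)).

(** Two discrepancies more than [1 - e] apart confine the phase to an interval shorter than [e], and
    every point that agrees with [x] up to [N] has its phase in the same interval. *)
Lemma factor_continuous : continuous factor.
Proof.
move=> x A /circle_pi_continuous /nbhs_ballP[e /= e0 eA].
have [N HN] := disc_range c irr e0.
apply/nbhs_subset; exists N => y wxy; apply: eA.
have [m [n [mN nN lt]]] := HN (ray (\val x)).
have dE k : (k <= N)%N -> disc a c (ray (\val y)) k = disc a c (ray (\val x)) k.
  by move=> kN; apply: eq_disc => i ik; apply: wxy; lia.
have := phaseP (set_valP x) m; have := phaseP (set_valP x) n.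
have := phaseP (set_valP y) m; have := phaseP (set_valP y) n.
rewrite !dE // /ball /= => h1 h2 h3 h4.
by rewrite ltr_norml; apply/andP; split; lra.
Qed.

Lemma ray_translate x j : ray (translate j%:Z x) = fun i => ray x (j + i)%N.
Proof. by apply/funext => i; rewrite /ray /translate; congr x; lia. Qed.

Lemma factor_equivariant : factor \o T = rotation a \o factor.
Proof.
apply/funext => x /=; rewrite /factor rotate_pi.
have := phase_shift 1 (phaseP (set_valP x)); rewrite -ray_translate => /phaseE.
rewrite [phase (\val _)](_ : _ = phase (translate 1 (\val x))) // => ->.
apply/circle_pi_eq; exists (- (occ c (ray (\val x)) 1)%:Z).
by rewrite /disc mulrNz mul1r /=; ring.
Qed.

Let rot_floor (t : R) (n : int) : int := Num.floor (t + n%:~R * a).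

Lemma rot_floorS t n :
  (rot_floor t (n + 1) == rot_floor t n) || (rot_floor t (n + 1) == rot_floor t n + 1).
Proof.
have e : t + (n + 1)%:~R * a = t + n%:~R * a + a by rewrite intrD1; ring.
rewrite /rot_floor e; set u := t + _ * a.
have /andP[h1 h2] := floor_itv u; have /andP[h3 h4] := floor_itv (u + a).
rewrite intrD1 in h2; rewrite intrD1 in h4; have [a0 a1] := andP a01.
have h5 : (Num.floor u)%:~R < (Num.floor (u + a))%:~R + 1 :> R by lra.
have h6 : (Num.floor (u + a))%:~R < (Num.floor u)%:~R + 1 + 1 :> R by lra.
move: h5 h6; rewrite -!intrD1 !ltr_int => h5 h6; lia.
Qed.

(** The letter [c] marks the jumps of the floor of [t + n * a], so counts telescope to differences
    of floors. *)
Lemma sturmian_point t : exists2 x, sturmian a c x &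
  is_phase a c (ray x) (t - (Num.floor t)%:~R).
Proof.
pose x : fullshift := fun n => if rot_floor t (n + 1) == rot_floor t n then ~~ c else c.
have discE (k : int) n : disc a c (fun n => x (k + n%:Z)) n =
    (rot_floor t (k + n%:Z) - rot_floor t k)%:~R - n%:R * a.
  congr (_ - _); rewrite -[LHS]/((occ c _ n)%:Z%:~R); congr (_ %:~R).
  elim: n => [|n IH]; first by rewrite /occ big_ord0 addr0 subrr.
  rewrite occS PoszD IH /x -addn1 PoszD addrA.
  have := rot_floorS t (k + n); case: eqP => [->|/eqP ne] /=.
    by case: c => /=; lia.
  by move/eqP => ->; rewrite eqxx; lia.
have bnd (k : int) n : disc a c (fun n => x (k + n%:Z)) n <= 
    t + k%:~R * a - (rot_floor t k)%:~R <= disc a c (fun n => x (k + n%:Z)) n + 1.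
  rewrite discE intrB; have := floor_itv (t + (k + n%:Z)%:~R * a).
  rewrite -/(rot_floor t (k + n)) intrD1 intrD /= => /andP[h1 h2].
  by apply/andP; split; lra.
exists x => [k m n|n].
  have := bnd k m; have := bnd k n => /andP[h1 h2] /andP[h3 h4].
  by rewrite ler_norml; apply/andP; split; lra.
have := bnd 0 n; rewrite /rot_floor mul0r addr0.
by rewrite (_ : (fun n => _) = ray x) //; apply/funext => i; rewrite add0r.
Qed.

Lemma factor_surjective s : exists x, factor x = s.
Proof.
have [t ->] := circle_piP s; have [x sx px] := sturmian_point t.
exists (exist _ x (mem_set sx)); rewrite /factor /= (phaseE px).
by apply/circle_pi_eq; exists (- Num.floor t); rewrite mulrNz.
Qed.

Lemma factor_fibre x y : factor x = factor y ->
  exists M, forall n, (M <= n)%N -> ray (\val x) n = ray (\val y) n.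
Proof.
move=> /circle_pi_eq[k e].
exact: (phase_tail_eq irr (phaseP (set_valP x)) (phaseP (set_valP y)) e).
Qed.

(* Points of a fibre of [factor] are asymptotic and [x] is recurrent, so [x] and
   [y] return simultaneously to any neighbourhood of [x]: [psi x] and [psi y]
   are proximal, hence equal. *)
Lemma equicontinuous_fibre (Z : topologicalType) (h : homeo Z)
    (psi : (X : set fullshift) -> Z) x y :
  equicontinuous_homeo R h -> continuous psi -> psi \o T = h \o psi ->
  factor x = factor y -> psi x = psi y.
Proof.
move=> [d md eqd] cpsi comm /factor_fibre[M HM].
have commn n z : psi (iter n T z) = iter n h (psi z).
  elim: n => // n IH; rewrite !iterS -IH; exact: (congr1 (@^~ _) comm).
have hK n z : iter n (hinv h) (iter n h z) = z.
  by elim: n z => // n IH z; rewrite iterSr iterS hmapK IH.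
apply/(metric_eq0 md); apply/eqP; rewrite eq_le.
have dxx z : d z z = 0 by apply/(metric_eq0 md).
have dge0 : 0 <= d (psi x) (psi y).
  have := metric_triang md (psi x) (psi y) (psi x).
  rewrite dxx (metric_symm md (psi y)); lra.
rewrite dge0 andbT; apply/ler_addgt0Pr => e e0; rewrite add0r; apply: ltW.
have [delta delta0 Hd] := eqd e e0.
have : nbhs (psi x) [set z | d (psi x) z < delta / 2].
  by apply/(metric_nbhs md); exists (delta / 2) => //; lra.
move=> /cpsi /nbhs_subset[K HK].
(* As [j >= M + K], the window around [j] lies where [x] and [y] agree. *)
have [j j0j wj] := sturmian_recurs_translate irr K (M + K) (set_valP x) (set_valP x).
have hx : d (psi x) (psi (iter j T x)) < delta / 2.
  by apply: HK; rewrite -[iter j T x]/(iterz T j x) val_iterz.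
have hy : d (psi x) (psi (iter j T y)) < delta / 2.
  apply: HK; rewrite -[iter j T y]/(iterz T j y) val_iterz => k kK.
  rewrite -wj // /translate; have := HM (absz (k + j%:Z)) ltac:(lia).
  by rewrite /ray (_ : _%:Z = k + j%:Z) //; lia.
have lt : d (psi (iter j T x)) (psi (iter j T y)) < delta.
  have := metric_triang md (psi (iter j T x)) (psi x) (psi (iter j T y)).
  by rewrite (metric_symm md _ (psi x)); lra.
(* Equicontinuity under negative iterates carries the closeness at time [j] back to time 0. *)
have := Hd _ _ lt (- j%:Z); rewrite !commn.
case: j {j0j wj hx hy lt} => [//|j].
by rewrite -NegzE /iterz !hK.
Qed.

Lemma sturmian_factor : maximal_equicontinuous_factor R T (rotation a).
Proof.
have cptX := closed_subset_compact_metrizable R (@sturmian_closed R a c).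
split=> //; [exact: circle_compact_metrizable|exact: rotation_equicontinuous|].
exists factor.
  split; [exact: factor_continuous|exact: factor_surjective|exact: factor_equivariant].
move=> Z h psi [cZ [d md]] eqh [cpsi spsi comm].
(* The choice of preimage is immaterial, since [psi] is constant on the fibres of [factor]. *)
pose theta s := psi (projT1 (cid (factor_surjective s))).
have thetaE x : theta (factor x) = psi x.
  rewrite /theta; case: cid => y /= e.
  exact: (equicontinuous_fibre eqh cpsi comm e).
have thetaC : psi = theta \o factor by apply/funext => x /=; rewrite thetaE.
exists theta => //; split.
(* Preimages of closed sets under [theta] are images under [factor] of compact sets, hence closed in
   the Hausdorff circle. *)
- apply/continuous_closedP => C closedC.
  have -> : theta @^-1` C = factor @` (psi @^-1` C).
    apply/seteqP; split=> [s /= Cs|_ [x Cx <-] /=]; last by rewrite thetaE.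
    by have [x e] := factor_surjective s; exists x => //; rewrite -thetaE e.
  have hs := compatible_metric_hausdorff (@circle_metric R).
  apply: (compact_closed hs).
  apply: continuous_compact.
    by apply: continuous_subspaceT; exact: factor_continuous.
  apply: (subclosed_compact _ cptX.1) => //.
  by move/continuous_closedP : cpsi; exact.
- by move=> z; have [x <-] := spsi z; exists (factor x).
- apply/funext => s; have [x <-] := factor_surjective s.
  have /(congr1 (@^~ x)) /= <- := factor_equivariant.
  by rewrite thetaE; rewrite /= thetaE; exact: (congr1 (@^~ x) comm).
Qed.

End SturmianFactor.

(** * Rank two *)

Section Buildings.
Implicit Types (u v w : word) (S : seq word).

Definition wpow (k : nat) (w : word) : word := flatten (nseq k w).

Lemma wpowSr k w : wpow k w ++ w = wpow k.+1 w.
Proof.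
rewrite /wpow; elim: k => [|k IH] /=; first by rewrite cats0.
by rewrite -catA IH.
Qed.

Lemma wpow_rot k u v : wpow k.+1 (u ++ v) = u ++ wpow k (v ++ u) ++ v.
Proof.
elim: k => [|k IH]; first by rewrite /wpow /= cats0.
by rewrite -[LHS]/((u ++ v) ++ wpow k.+1 (u ++ v)) IH /wpow /= -!catA.
Qed.

Definition bword v (l : seq (nat * word)) : word :=
  v ++ flatten [seq nseq p.1 true ++ p.2 | p <- l].

Lemma bword_built S v l : v \in S -> all (fun p => p.2 \in S) l -> l != [::] ->
  built_from_starting S v (bword v l).
Proof. by move=> vS lS l0; exists (Building vS lS l0 erefl). Qed.

Lemma built_from_startingW S v w : built_from_starting S v w -> built_from S w.
Proof. by case=> b _; exists b. Qed.

Lemma starts_ends_0_bword v l : starts_ends_0 v ->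
  all (fun p => starts_ends_0 p.2) l -> starts_ends_0 (bword v l).
Proof.
rewrite /bword; elim: l v => [|[s w] l IH] v sv /=; first by rewrite cats0.
move=> /andP[/= sw al]; rewrite !catA; apply: IH al; rewrite /starts_ends_0.
have [hv _] := andP sv; have [_ lw] := andP sw; apply/andP; split.
  by case: (v) hv.
by rewrite last_cat; case: (w) lw.
Qed.

Lemma built_starts_ends_0 S w : built_from S w -> all starts_ends_0 S -> starts_ends_0 w.
Proof.
case=> [[v l vS lS l0 ->]] _ /allP aS; apply: starts_ends_0_bword; first exact: aS.
by apply: sub_all lS => p /aS.
Qed.

Lemma built_size S v w : built_from_starting S v w -> all starts_ends_0 S ->
  (size v < size w)%N.
Proof.
case=> [[u l vS lS l0 e]] /= <- /allP aS; rewrite e; clear e; case: l lS l0 => // [[s x] l] /= /andP[/aS sx _] _.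
by case: x sx => // b x _; rewrite !size_cat size_nseq /=; lia.
Qed.

(** With [A = P 1^s] and [B = Q 1^s'], this identity and the next write [A^(k+1) B] and [A B^(k+1)]
    as a building from [P] and [Q] followed by [1^s']. *)
Lemma bword_pow_l k s P Q :
  wpow k.+1 (P ++ nseq s true) ++ Q = bword P (nseq k (s, P) ++ [:: (s, Q)]).
Proof.
by rewrite wpow_rot /bword map_cat map_nseq flatten_cat /= cats0 -!catA.
Qed.

Lemma bword_pow_r k s s' P Q :
  P ++ nseq s true ++ wpow k.+1 (Q ++ nseq s' true) =
  bword P ((s, Q) :: nseq k (s', Q)) ++ nseq s' true.
Proof. by rewrite wpow_rot /bword /= map_nseq -!catA. Qed.

End Buildings.

(** * Rokhlin towers of a two-interval exchange and their induction *)

Section Towers.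
Variables (R : realType) (g : R).

(** On [[0, 1)] this is the rotation by [- g] modulo 1. *)
Definition rot (x : R) : R := if x < g then x + (1 - g) else x - g.

Fixpoint reads (x : R) (w : word) (y : R) : Prop :=
  if w is b :: w' then b = ~~ (x < g) /\ reads (rot x) w' y else x = y.

Lemma reads_cat x u y w z : reads x u y -> reads y w z -> reads x (u ++ w) z.
Proof. by elim: u x => [|b u IH] x /= => [->//|[-> /IH h] /h]. Qed.

Lemma reads_nth x w y i : reads x w y -> (i < size w)%N ->
  nth true w i = ~~ (iter i rot x < g).
Proof.
elim: w x i => // b w IH x [|i] /= [e r] iw; first by rewrite e.
by rewrite (IH _ _ r iw) -iterSr.
Qed.

(* Two-interval Rokhlin towers over [0, p + q): the return map exchanges
   [0, p) and [p, p + q), and [A], [B] are the names of the two towers. *)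
Definition tower (A B : word) (p q : R) : Prop :=
  [/\ 0 < p, 0 < q, forall m n : nat, m%:R * p = n%:R * q -> m = 0%N,
      forall x, 0 <= x < p -> reads x A (x + q) &
      forall x, p <= x < p + q -> reads x B (x - p)].

Lemma tower_neq A B p q k : tower A B p q -> p != k%:R * q.
Proof.
by case=> _ _ ind _ _; apply/eqP => e; have := ind 1%N k; rewrite mul1r => /(_ e).
Qed.

Lemma tower_neq_r A B p q k : tower A B p q -> q != k%:R * p.
Proof.
case=> p0 q0 ind _ _; apply/eqP => e; have := ind k 1%N; rewrite mul1r => /(_ (esym e)) k0.
by move: q0; rewrite e k0 mul0r ltxx.
Qed.

(** Inducing on [[0, p)]: points below [p - q] return along [A]; the others land in [[p, p + q)] and
    come back along [B]. *)
Lemma tower_left A B p q : q < p -> tower A B p q -> tower A (A ++ B) (p - q) q.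
Proof.
move=> qp [p0 q0 ind rA rB]; split=> //; first lra.
- move=> m n e; have := ind m (n + m)%N; rewrite natrD => /(_ ltac:(lra)); lia.
- by move=> x hx; apply: rA; lra.
- move=> x hx; have := rB (x + q) ltac:(lra).
  have -> : x + q - p = x - (p - q) by ring.
  by apply: reads_cat; apply: rA; lra.
Qed.

(** Inducing on [[0, q)]: points below [p] leave it along [A] and come back along [B]; the others
    return along [B]. *)
Lemma tower_right A B p q : p < q -> tower A B p q -> tower (A ++ B) B p (q - p).
Proof.
move=> pq [p0 q0 ind rA rB]; split=> //; first lra.
- move=> m n e; have := ind (m + n)%N n; rewrite natrD => /(_ ltac:(lra)); lia.
- move=> x hx; have := rB (x + q) ltac:(lra); rewrite -addrA.
  by apply: reads_cat; apply: rA; lra.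
- by move=> x hx; apply: rB; lra.
Qed.

Lemma tower_left_iter A B p q k : k%:R * q < p -> tower A B p q ->
  tower A (wpow k A ++ B) (p - k%:R * q) q.
Proof.
move=> + t; have [p0 q0 _ _ _] := t.
elim: k => [|k IH]; first by rewrite mul0r subr0.
rewrite -natr1 => h; have := tower_left _ (IH _).
rewrite (_ : p - k%:R * q - q = p - (k%:R + 1) * q); last ring.
by rewrite /wpow /= -catA; apply; lra.
Qed.

Lemma tower_right_iter A B p q k : k%:R * p < q -> tower A B p q ->
  tower (A ++ wpow k B) B p (q - k%:R * p).
Proof.
move=> + t; have [p0 q0 _ _ _] := t.
elim: k => [|k IH]; first by rewrite mul0r subr0 cats0.
rewrite -natr1 => h; have := tower_right _ (IH _).
rewrite (_ : q - k%:R * p - p = q - (k%:R + 1) * p); last ring.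
by rewrite -catA wpowSr; apply; lra.
Qed.

Lemma euclid_quotient (p q : R) : 0 < q -> q < p -> (forall k : nat, p != k%:R * q) ->
  exists k : nat, k.+1%:R * q < p < k.+2%:R * q.
Proof.
move=> q0 qp ne.
have h : 0 <= p / q by apply: divr_ge0; lra.
have /andP[h1 h2] := truncn_itv h; set k := Num.truncn _ in h1 h2.
rewrite ler_pdivlMr // in h1; rewrite ltr_pdivrMr // in h2.
case: k h1 h2 => [|k] h1 h2; first by lra.
by exists k; rewrite h2 andbT lt_neqAle h1 andbT eq_sym ne.
Qed.

(** All possible left steps, then one right step. Both new names begin with [A] and end with [B]:
    the new words start with [P], and both inherit the final run of [B]. *)
Lemma tower_step_left A B p q : q < p -> tower A B p q -> exists k p' q',
  tower (wpow k.+2 A ++ B) (wpow k.+1 A ++ B) p' q'.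
Proof.
move=> qp t; have [p0 q0 _ _ _] := t.
have [k /andP[h1 h2]] := euclid_quotient q0 qp (fun k => tower_neq k t).
have := tower_right _ (tower_left_iter h1 t).
rewrite catA -/(wpow k.+2 A) => h; exists k, (p - k.+1%:R * q), (q - (p - k.+1%:R * q)).
by apply: h; rewrite -natr1 in h2; lra.
Qed.

Lemma tower_step_right A B p q : p < q -> tower A B p q -> exists k p' q',
  tower (A ++ wpow k.+1 B) (A ++ wpow k.+2 B) p' q'.
Proof.
move=> pq t; have [p0 q0 _ _ _] := t.
have [k /andP[h1 h2]] := euclid_quotient p0 pq (fun k => tower_neq_r k t).
have := tower_left _ (tower_right_iter h1 t).
rewrite -catA wpowSr => h; exists k, (p - (q - k.+1%:R * p)), (q - k.+1%:R * p).
by apply: h; rewrite -natr1 in h2; lra.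
Qed.

(** A tower name is split into a word ending in 0 and the length of its final run of 1, because the
    words of a generating sequence must end in 0. *)
Record two_words := TwoWords {
  fst_word : word; fst_gap : nat; snd_word : word; snd_gap : nat }.

Definition two_tower (z : two_words) : Prop :=
  [/\ starts_ends_0 (fst_word z), starts_ends_0 (snd_word z) &
      exists p q, tower (fst_word z ++ nseq (fst_gap z) true)
                        (snd_word z ++ nseq (snd_gap z) true) p q].

Definition two_built (z z' : two_words) : Prop :=
  built_from_starting [:: fst_word z; snd_word z] (fst_word z) (fst_word z') /\
  built_from [:: fst_word z; snd_word z] (snd_word z').

Lemma two_tower_step z : two_tower z -> exists2 z', two_tower z' & two_built z z'.
Proof.
case: z => P s Q s' [/= sP sQ [p [q t]]].
have build l l' : all (fun r => r.2 \in [:: P; Q]) l -> l != [::] ->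
    all (fun r => r.2 \in [:: P; Q]) l' -> l' != [::] ->
    forall s2 s2',
    (exists p q, tower (bword P l ++ nseq s2 true) (bword P l' ++ nseq s2' true) p q) ->
    exists2 z', two_tower z' & two_built (TwoWords P s Q s') z'.
  move=> aP l0 aP' l0' s2 s2' ht.
  have PS : P \in [:: P; Q] by rewrite inE eqxx.
  have aS : all starts_ends_0 [:: P; Q] by rewrite /= sP sQ.
  have b1 := bword_built PS aP l0; have b2 := built_from_startingW (bword_built PS aP' l0').
  exists (TwoWords (bword P l) s2 (bword P l') s2') => //; split=> //=.
    exact: built_starts_ends_0 (built_from_startingW b1) aS.
  exact: built_starts_ends_0 b2 aS.
have Pin : P \in [:: P; Q] by rewrite inE eqxx.
have Qin : Q \in [:: P; Q] by rewrite !inE eqxx orbT.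
have all_nseq k r w : w \in [:: P; Q] ->
    all (fun r : nat * word => r.2 \in [:: P; Q]) (nseq k (r, w)).
  by move=> h; rewrite all_nseq /= h orbT.
have [qp|pq|e] := ltrgtP q p.
- have [k [p' [q' t']]] := tower_step_left qp t.
  apply: (build (nseq k.+1 (s, P) ++ [:: (s, Q)]) (nseq k (s, P) ++ [:: (s, Q)]) _ _ _ _ s' s').
  + by rewrite all_cat all_nseq //= Qin.
  + by [].
  + by rewrite all_cat all_nseq //= Qin.
  + by case: (k).
  by exists p', q'; rewrite -!bword_pow_l -(catA (wpow k.+2 _)) -(catA (wpow k.+1 _)).
- have [k [p' [q' t']]] := tower_step_right pq t.
  apply: (build ((s, Q) :: nseq k (s', Q)) ((s, Q) :: nseq k.+1 (s', Q)) _ _ _ _ s' s') => //.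
  + by rewrite /= Qin all_nseq.
  + by rewrite /= Qin all_nseq.
  by exists p', q'; rewrite -!bword_pow_r !(catA P).
- by have := tower_neq 1 t; rewrite mul1r e eqxx.
Qed.

Hypotheses (g0 : 0 < g) (g12 : g < 2^-1) (irr : irrational g).

Lemma tower0 : tower [:: false] [:: true] g (1 - g).
Proof.
split=> //; first by have := g12; lra.
- move=> m n e; have := @irrational_int R g (m + n)%N n irr.
  by rewrite -[_%:~R]/((m + n)%:R) -[n%:~R]/(n%:R) natrD => /(_ ltac:(lra)); lia.
- by move=> x /andP[x0 xg] /=; rewrite /rot xg.
- move=> x /andP[x0 xg] /=; rewrite /rot ltNge x0 /=; split=> //.
Qed.

Definition coding (n : nat) : bool := ~~ (iter n rot 0 < g).

(** The initial name 1 of the second tower contains no 0. Since [g < 1 - g], a first right step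
    gives the names [0 1^(k+1)] and [0 1^(k+2)], and both words are 0. *)
Lemma two_tower_exists : exists2 z, two_tower z &
  fst_word z = [:: false] /\ snd_word z = [:: false].
Proof.
have [|k [p [q t]]] := tower_step_right _ tower0; first by have := g12; lra.
have wpow1 m : wpow m [:: true] = nseq m true by rewrite /wpow; elim: m => //= m ->.
rewrite !wpow1 in t.
by exists (TwoWords [:: false] k.+1 [:: false] k.+2) => //; split=> //; exists p, q.
Qed.

(** A step of [rot] adds [1 - g] at a letter 0 and [- g] at a letter 1, exactly as the discrepancy
    does. *)
Lemma coding_disc n : disc g false coding n = iter n rot 0 /\ 0 <= iter n rot 0 < 1.
Proof.
elim: n => [|n [IH1 /andP[x0 x1]]]; first by rewrite disc0 /= lexx ltr01.
have e : disc g false coding n.+1 = disc g false coding n + (coding n == false)%:R - g.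
  by rewrite /disc occS natrD -natr1; ring.
rewrite e IH1 iterS /coding; set x := iter n rot 0 in x0 x1 *.
have h1 := g0; have h2 := g12; rewrite /rot; case: (ltP x g) => h /=; split; first lra.
- by apply/andP; split; lra.
- lra.
- by apply/andP; split; lra.
Qed.

Lemma coding_balanced : balanced g false coding.
Proof.
move=> m n; have [-> /andP[h1 h2]] := coding_disc m; have [-> /andP[h3 h4]] := coding_disc n.
by rewrite ler_norml; apply/andP; split; lra.
Qed.

Lemma subshift_of_balanced (c : bool) (V : nat -> bool) :
  balanced g c V -> subshift_of_word V = sturmian g c.
Proof.
move=> bV; apply/seteqP; split=> x xX.
  move=> k m n.
  have [|j] := xX (mkseq (fun i => x (k + i%:Z)) (m + n)).
    by exists k; rewrite size_mkseq.
  rewrite size_mkseq => e.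
  have e' i : (i < m + n)%N -> x (k + i%:Z) = V (j + i)%N.
    by move=> h; have := congr1 (fun u => nth true u i) e; rewrite !nth_mkseq.
  rewrite !(@eq_disc _ g c _ (fun i => V (j + i)%N)).
  - exact: balanced_shift.
  - by move=> i h; apply: e'; lia.
  - by move=> i h; apply: e'; lia.
move=> u [k e]; have [j _ h] := window_recurs irr (size u) 0 (xX k) bV.
exists j; rewrite {1}e; apply/eq_in_map => i; rewrite mem_iota add0n => hi.
exact/esym/h.
Qed.

Lemma sturmian_rank2 : has_rank_construction (sturmian g false) 2.
Proof.
have [z0 tz0 [z01 z02]] := two_tower_exists.
pose next (z : {z | two_tower z}) : {z | two_tower z} :=
  let e := cid2 (two_tower_step (projT2 z)) in exist _ (s2val e) (s2valP e).
pose z i : two_words := projT1 (iter i next (exist _ z0 tz0)).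
have tz i : two_tower (z i) := projT2 (iter i next (exist _ z0 tz0)).
have bz i : two_built (z i) (z i.+1).
  by rewrite /z iterS /next /=; case: cid2.
pose gw i j := if j == 1%N then fst_word (z i) else snd_word (z i).
have lev i : level (fun=> 2%N) gw i = [:: fst_word (z i); snd_word (z i)] by [].
have gF i j : (1 <= j <= 2)%N -> starts_ends_0 (gw i j).
  by move=> _; rewrite /gw; case: (tz i) => h1 h2 _; case: eqP.
have gw0 j : (1 <= j <= 2)%N -> gw 0%N j = [:: false].
  by move=> _; rewrite /gw; case: eqP; rewrite -[z 0%N]/z0 ?z01 ?z02.
have gw1 i : built_from_starting (level (fun=> 2%N) gw i) (gw i 1%N) (gw i.+1 1%N).
  by rewrite lev; case: (bz i).
have gw2 i j : (2 <= j <= 2)%N -> built_from (level (fun=> 2%N) gw i) (gw i.+1 j).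
  by rewrite lev /gw; case: eqP => [->//|_ _]; case: (bz i).
pose gs := @GeneratingSequence 2 (fun=> 2%N) gw (fun=> isT) gF gw0 gw1 gw2.
(* The clause for [j = 1] makes this single choice of buildings also satisfy [cbuilding1]. *)
have cb i j (h : (1 <= j <= gsize gs i.+1)%N) :
    { b : building (level (gsize gs) (gword gs) i) (gword gs i.+1 j) |
      j = 1%N -> bhead b = gword gs i 1%N }.
  apply: cid; have [j1|j1] := eqVneq j 1%N.
    by rewrite j1; have [b eb] := gw1 i; exists b.
  have [|b _] := gw2 i j; first by move: h j1 => /=; lia.
  by exists b => j1'; rewrite j1' eqxx in j1.
exists coding, (@RankConstruction 2 gs (fun i j h => projT1 (cb i j h))
  (fun i h => projT2 (cb i 1%N h) erefl)); split; last first.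
  by rewrite (subshift_of_balanced coding_balanced).
have sz i : (i < size (fst_word (z i)))%N.
  elim: i => [|i IH]; first by rewrite -[z 0%N]/z0 z01.
  have [b1 _] := bz i; have [s1 s2 _] := tz i.
  by apply: leq_ltn_trans IH (built_size b1 _); rewrite /= s1 s2.
move=> k; exists k => // i /= ki; have ksz := leq_ltn_trans ki (sz i).
(* The point 0 lies in the base of the first tower, so the name of that tower is a prefix of the
   itinerary of 0. *)
split=> //; have [_ _ [p [q [p0 q0 _ rA _]]]] := tz i.
have := rA 0; rewrite lexx p0 => /(_ isT) rd.
have := @reads_nth _ _ _ k rd; rewrite nth_cat ksz size_cat; apply; exact: ltn_addr.
Qed.

End Towers.

(** * Rank one is excluded *)

(** A cluster point of the shifts of [V] to returns [q n >= n] of its prefixes. The values that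
    [absz] invents lie left of [- q n] and leave every window. *)
Lemma recurrent_extension (V : nat -> bool) :
  (forall n, exists2 q, (n <= q)%N & forall i, (i < n)%N -> V (q + i)%N = V i) ->
  exists2 x, subshift_of_word V x & ray x = V.
Proof.
move=> rec.
have [q qP] : exists q : nat -> nat, forall n,
    (n <= q n)%N /\ forall i, (i < n)%N -> V (q n + i)%N = V i.
  pose P n m := (n <= m)%N /\ forall i, (i < n)%N -> V (m + i)%N = V i.
  have [|q qP] := @boolp.choice nat nat P; last by exists q.
  by move=> n; have [m] := rec n; exists m.
pose y n : fullshift := fun k => V (absz (k + (q n)%:Z)).
have [x [_ clx]] := @fullshift_compact (y @ \oo) _ (@filterT _ (y @ \oo) _).
have near K N : exists2 n, (N <= n)%N & window x K (y n).
  have [||_ [[n Nn <-] w]] := clx (y @` [set n | (N <= n)%N]) (window x K).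
  - by exists N => // n Nn; exists n.
  - by apply/nbhs_fullshift; exists K.
  by exists n.
exists x => [u [k e]|].
  have [n kn w] := near (`|k| + size u)%N `|k|%N.
  have [qn _] := qP n.
  exists (absz (k + (q n)%:Z)); rewrite {1}e; apply/eq_in_map => i.
  rewrite mem_iota add0n => hi; rewrite -w; last lia.
  by rewrite /y; congr V; lia.
apply/funext => i; have [n ni w] := near i.+1 i.+1; have [qn Vq] := qP n.
by rewrite /ray -w // /y -(Vq i ni); congr V; lia.
Qed.

Section PrefixDiscrepancy.
Variables (R : realType) (g : R).
Implicit Types (y : nat -> bool) (u v w : word).

Definition has_prefix y w := forall i, (i < size w)%N -> y i = nth true w i.

Lemma has_prefix_cat y u w : has_prefix y (u ++ w) ->
  has_prefix y u /\ has_prefix (fun i => y (size u + i)%N) w.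
Proof.
move=> h; split=> i hi.
  by rewrite h ?nth_cat ?hi // size_cat ltn_addr.
by rewrite h ?size_cat ?ltn_add2l // nth_cat ltnNge leq_addr /= addKn.
Qed.

Definition word_disc w (n : nat) : R := disc g false (nth true w) n.

Lemma has_prefix_disc y w n : has_prefix y w -> (n <= size w)%N ->
  disc g false y n = word_disc w n.
Proof. by move=> h nw; apply: eq_disc => i hi; apply: h; exact: leq_trans nw. Qed.

Lemma word_disc_ones k : word_disc (nseq k true) k = - (k%:R * g).
Proof.
rewrite /word_disc /disc /occ big1 ?sub0r // => i _.
by rewrite nth_nseq ltn_ord.
Qed.

Definition spaced v (s : seq nat) : word := bword v [seq (x, v) | x <- s].

Lemma spaced_cons v x s : spaced v (x :: s) = v ++ nseq x true ++ spaced v s.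
Proof. by rewrite /spaced /bword /= -!catA. Qed.

Lemma spaced_cat v s x t :
  spaced v (s ++ x :: t) = spaced v s ++ nseq x true ++ spaced v t.
Proof.
elim: s => [|z s IH]; first by rewrite /= spaced_cons /spaced /bword cats0.
by rewrite cat_cons !spaced_cons IH -!catA.
Qed.

(** Flattening two levels keeps [s] as an initial part of the gap list, so the first gap never
    changes, while the list gets longer. *)
Lemma spaced_spaced v s t : exists s', spaced (spaced v s) t = spaced v (s ++ s') /\
  (size t <= size s')%N.
Proof.
elim: t s => [|x t IH] s.
  by exists [::]; rewrite cats0 {1}/spaced /bword cats0.
have [s' [e le]] := IH s; exists (x :: s ++ s'); split.
  by rewrite spaced_cons e spaced_cat.
by rewrite /= size_cat ltnS (leq_trans le) // leq_addl.
Qed.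

Lemma disc_gap y v x w n : has_prefix y (v ++ nseq x true ++ w) -> (n <= size w)%N ->
  disc g false y (size v + x + n) = word_disc v (size v) - x%:R * g + word_disc w n.
Proof.
move=> /has_prefix_cat[h1 /has_prefix_cat[h2 h3]] nw.
rewrite -addnA discD (has_prefix_disc h1) // discD -{1}(size_nseq x true).
rewrite (has_prefix_disc h2) // size_nseq word_disc_ones.
rewrite size_nseq in h3; rewrite (has_prefix_disc h3) //; ring.
Qed.

(* [v] occurs at [0] and at [size v + x]; comparing windows that start and end
   at the extremal discrepancies of these two copies shows that the two copies
   differ in discrepancy by less than [g / 2], which determines [x]. *)
Lemma spaced_gap y v s x m n : balanced g false y -> has_prefix y (spaced v s) ->
  x \in s -> (m <= size v)%N -> (n <= size v)%N ->
  1 - g / 2 < word_disc v m - word_disc v n ->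
  `|word_disc v (size v) - x%:R * g| < g / 2.
Proof.
move=> + + + mv nv big; elim: s y => // z s IH y by1 py.
have py' := py; rewrite spaced_cons in py'.
rewrite inE => /orP[/eqP ->|xs]; last first.
  have [_ py2] := has_prefix_cat py'; have [_ py3] := has_prefix_cat py2.
  exact: (IH _ (balanced_shift _ (balanced_shift _ by1)) py3 xs).
have le k : (k <= size v)%N -> (k <= size (spaced v s))%N.
  by move=> h; rewrite size_cat (leq_trans h) // leq_addr.
have wE k : (k <= size v)%N -> word_disc (spaced v s) k = word_disc v k.
  by move=> kv; apply: eq_disc => i ik; rewrite nth_cat (leq_trans ik kv).
have [py1 _] := has_prefix_cat py'.
have h1 := by1 (size v + z + m)%N n; have h2 := by1 (size v + z + n)%N m.
rewrite (disc_gap py' (le _ _)) // wE // (has_prefix_disc py1) // in h1.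
rewrite (disc_gap py' (le _ _)) // wE // (has_prefix_disc py1) // in h2.
move: h1 h2; rewrite !ler_norml => /andP[_ h1] /andP[h2 _].
rewrite ltr_norml; apply/andP; split; lra.
Qed.

Lemma spaced_const_disc y v x k : has_prefix y (spaced v (nseq k x)) ->
  disc g false y (k * (size v + x)) = k%:R * (word_disc v (size v) - x%:R * g).
Proof.
elim: k y => [|k IH] y; first by rewrite disc0 mul0r.
rewrite spaced_cons mulSn discD => py; have := disc_gap py (leq0n _).
rewrite addn0 [word_disc (spaced _ _) 0]disc0 addr0 => ->.
have [_ py1] := has_prefix_cat py; have [_ py2] := has_prefix_cat py1.
rewrite (_ : (fun i => y (size v + x + i)%N) = fun i => y (size v + (size (nseq x true) + i))%N).
  by rewrite (IH _ py2) -natr1; ring.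
by apply/funext => i; rewrite size_nseq addnA.
Qed.

Lemma balanced_not_rank1 (V : nat -> bool) (c : rank_construction 1) :
  0 < g -> irrational g -> construction_of c V ->
  subshift_of_word V = sturmian g false -> False.
Proof.
move=> g0 irr cV XV; pose v i := gword c i 1.
have sz1 i : gsize c i = 1%N.
  by apply/eqP; have := gsize_bounds c i; rewrite eqn_leq andbC.
have sv i : starts_ends_0 (v i) by apply: gword_F; rewrite sz1.
have vS i : exists x s, v i.+1 = spaced (v i) (x :: s).
  have [[w l wS lS l0 e] /= wv] := gword1_built c i.
  have lE : l = [seq (x, v i) | x <- map fst l].
    rewrite -map_comp -[LHS]map_id; apply/eq_in_map => -[x w'] /(allP lS) /=.
    by rewrite /level sz1 /= inE => /eqP ->.
  case: l lS l0 lE e => // -[x w'] l lS _ lE e.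
  by exists x, (map fst l); rewrite /v e wv {1}lE.
(* A single first gap [x] serves all later stages, with arbitrarily many gaps after it. *)
have vadd i : exists x, forall k, exists s,
    v (i + k).+1 = spaced (v i) (x :: s) /\ (k <= size s)%N.
  have [x [s e]] := vS i; exists x; elim=> [|k [t [et kt]]].
    by exists s; rewrite addn0.
  have [x' [s' e']] := vS (i + k).+1.
  have [t' [et' le]] := spaced_spaced (v i) (x :: t) (x' :: s').
  exists (t ++ t'); rewrite addnS e' et et'; split=> //.
  by rewrite size_cat -addn1 leq_add //; apply: leq_trans le.
have pre i t : spaced (v i) t = v i ++ drop (size (v i)) (spaced (v i) t).
  by rewrite /spaced /bword drop_size_cat.
have szv i : (i < size (v i))%N.
  elim: i => [|i IH]; first by case: (v 0%N) (sv 0%N).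
  apply: leq_ltn_trans IH (built_size (gword1_built c i) _).
  by rewrite /level sz1 /= [starts_ends_0 _]sv.
have VE i : has_prefix V (v i).
  move=> n ni; have [N _ HN] := cV n; have [_ <-] := HN (i + N).+1 ltac:(rewrite /=; lia).
  have [x /(_ N)[s [e _]]] := vadd i.
  by rewrite -/(v _) e pre nth_cat ni.
(* The prefix [v n] recurs inside [v n.+1], so [V] is the ray of a point of the subshift and
   inherits its balance. *)
have [x0 sx0 rx0] : exists2 x, subshift_of_word V x & ray x = V.
  apply: recurrent_extension => n.
  have [x [s e]] := vS n.
  have := VE n.+1; rewrite e spaced_cons => /has_prefix_cat[_ /has_prefix_cat[_ h]].
  exists (size (v n) + x)%N; first by rewrite (leq_trans (ltnW (szv n))) // leq_addr.
  move=> i ilt; have iv : (i < size (v n))%N by exact: ltn_trans (szv n).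
  have := h i; rewrite size_nseq addnA => ->.
    by rewrite pre nth_cat iv (VE n).
  by rewrite pre size_cat ltn_addr.
have bV : balanced g false V by rewrite -rx0; apply: sturmian_ray; rewrite -XV.
(* The bound [N] comes before the word: [v N] has more than [N] letters, so the spread is attained
   inside it. *)
have [N HN] := disc_range false irr (e := g / 2) ltac:(lra).
have [m [n [mN nN big]]] := HN (nth true (v N)).
have Nv := ltnW (szv N).
have [x Hx] := vadd N; set D := word_disc (v N) (size (v N)) - x%:R * g.
have gap s z : has_prefix V (spaced (v N) s) -> z \in s ->
    `|word_disc (v N) (size (v N)) - z%:R * g| < g / 2.
  move=> ps zs; apply: (spaced_gap bV ps zs (leq_trans mN Nv) (leq_trans nN Nv) big).
have kD k : k%:R * `|D| <= 1.
  have [s [e ks]] := Hx k.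
  have ps : has_prefix V (spaced (v N) (x :: s)) by rewrite -e.
  (* Two gaps whose multiples of [g] are both within [g / 2] of the same number are equal. *)
  have cs : x :: s = nseq (size s).+1 x.
    apply/all_pred1P/allP => z zs /=; apply/eqP.
    have h1 := gap _ z ps zs; have h2 := gap _ x ps (mem_head _ _).
    have : `|z%:R * g - x%:R * g| < g.
      have := ler_distD (word_disc (v N) (size (v N))) (z%:R * g) (x%:R * g).
      by rewrite (distrC _ (word_disc _ _)); lra.
    by rewrite -mulrBl normrM (gtr0_norm g0) gtr_pMl // => /(@natr_near_eq R).
  rewrite cs in ps; have := spaced_const_disc ps.
  have := bV ((size s).+1 * (size (v N) + x))%N 0%N; rewrite disc0 subr0 => + e1.
  rewrite e1 normrM normr_nat; apply: le_trans; apply: ler_wpM2r => //.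
  by rewrite ler_nat; exact: leqW.
(* [D] is an integer minus a positive multiple of [g], hence nonzero, yet all its multiples are
   bounded by 1. *)
have D0 : 0 < `|D|.
  rewrite normr_gt0; apply/eqP => D0.
  have := @irrational_int R g (size (v N) + x)%N (occ false (nth true (v N)) (size (v N))) irr.
  rewrite -[_%:~R]/((size (v N) + x)%:R) -[X in _ = X]/(_%:R) natrD.
  move: D0; rewrite /D /word_disc /disc => D0 /(_ ltac:(lra)).
  by have := szv N; lia.
have := kD (Num.truncn `|D|^-1).+1; rewrite -ler_pdivlMr // mul1r leNgt.
by rewrite truncnS_gt.
Qed.

End PrefixDiscrepancy.

Theorem mainTheorem17 (R : realType) (alpha : R)
    (alpha_bounds : 0 < alpha < 1) (alpha_irrational : irrational alpha) :
  exists X : subshift,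
    [/\ minimal (subshift_map X),
        symbolic_rank X 2 &
        maximal_equicontinuous_factor R (subshift_map X) (rotation alpha)].
Proof.
(* The letter of frequency [alpha] is 1 if [alpha > 1/2] and 0 otherwise, so 0 always has frequency
   [g < 1/2]. *)
pose c := 2^-1 < alpha; pose g := if c then 1 - alpha else alpha.
have girr : irrational g.
  by rewrite /g /c; case: (2^-1 < alpha) => //; exact: irrational_opp1.
have [a0 a1] := andP alpha_bounds.
have ne : alpha != 2^-1.
  apply/eqP => e; apply: alpha_irrational; exists (2^-1) => //.
  by rewrite e fmorphV /= ratr_nat.
have [g0 g12] : 0 < g /\ g < 2^-1.
  rewrite /g /c; case: (ltrgtP alpha 2^-1) ne => //= h _; split; lra.
have XE : sturmian alpha c = sturmian g false.
  by rewrite /g /c; case: (2^-1 < alpha) => //; exact: sturmian_compl.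
exists (sturmian_subshift alpha c); split.
- exact: sturmian_minimal.
- split=> //; first by rewrite /= XE; exact: sturmian_rank2.
  move=> [|[|m]] // _ [V [d [dV]]]; rewrite /= XE => /esym e.
  by case: (balanced_not_rank1 g0 girr dV e).
- exact: sturmian_factor.
Qed.
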